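(* Let $A_2,A_3\subset[0,1]$ be closed sets such that $A_2$ is $\times 2 \bmod 1$ invariant and $A_3$ is $\times 3\bmod 1$ invariant, and assume $\dim_{\mathrm H}A_2+\dim_{\mathrm H}A_3<1$. For real numbers $u\neq 0$ and $v$ put $l_{u,v}=A_2\cap(uA_3+v)\subset\mathbb{R}$. Then for every $u\ne0$, $v\in\mathbb{R}$ and every $a\in l_{u,v}$, the set $l_{u,v}$ is super sparse near $a$. Moreover the estimate is uniform: for every $\gamma>0$ and every $\varepsilon>0$ there is $N_0\in\mathbb{N}$ such that for all $u$ with $|u|\in(\gamma,\gamma^{-1})$, all $v\in\mathbb{R}$, all $a\in l_{u,v}$, all $k\in\mathbb{N}$ and all $N\ge N_0$, \[ \#\big(W(l_{u,v},a)\cap[k+1,k+N]\big)\le \varepsilon N . \]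
   Context: A closed set $A\subset[0,1]$ is called $\times p\bmod 1$ invariant ($p\ge2$ an integer) if $\{pa\}\in A$ for every $a\in A$, where $\{x\}$ denotes the fractional part. $\dim_{\mathrm H}$ is Hausdorff dimension. For a compact set $l\subset\mathbb{R}$ let $W(l)=\{k\in\mathbb{N}: l\cap([2^{-k-1},2^{-k}]\cup[-2^{-k},-2^{-k-1}])\neq\emptyset\}$, and for $a\in l$ let $W(l,a)=W(l-a)$ (the sparse index of $l$ near $a$). The upper natural density of $W\subset\mathbb{N}$ is $\limsup_{n\to\infty}\#(W\cap[1,n])/n$ and its upper Banach density is $\limsup_{N\to\infty}\sup_{k\in\mathbb{N}}\#(W\cap[k+1,k+N])/N$. The set $l$ is sparse near $a$ if $W(l,a)$ has upper natural density $0$ and super sparse near $a$ if $W(l,a)$ has upper Banach density $0$. *)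

(* Defs.v *)
From Stdlib Require Import Reals Lra Lia ClassicalEpsilon.
Open Scope R_scope.

Definition times_p_invariant (p : nat) (A : R -> Prop) : Prop :=
  forall a, A a -> A (frac_part (INR p * a)).

(** s-dimensional Hausdorff measure of A is zero: for every δ > 0 the
    δ-approximate Hausdorff measure H^s_δ(A) = inf { Σ diam(U_n)^s : A ⊂ ⋃ U_n,
    diam U_n ≤ δ } is zero.  The bound r n is an upper bound for diam (U n)
    (|x-y| ≤ r n for x,y ∈ U n); taking r n > 0 strictly does not change the
    infimum (for s > 0). *)
Definition Hnull (s : R) (A : R -> Prop) : Prop :=
  forall delta eps : R, 0 < delta -> 0 < eps ->
  exists (U : nat -> R -> Prop) (r : nat -> R),
    (forall n, 0 < r n <= delta) /\
    (forall n x y, U n x -> U n y -> Rabs (x - y) <= r n) /\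
    (forall x, A x -> exists n, U n x) /\
    (forall N, sum_f_R0 (fun n => Rpower (r n) s) N <= eps).

Definition is_inf (S : R -> Prop) (m : R) : Prop :=
  (forall s, S s -> m <= s) /\ (forall m', (forall s, S s -> m' <= s) -> m' <= m).

Definition is_dimH (A : R -> Prop) (d : R) : Prop :=
  is_inf (fun s => 0 <= s /\ Hnull s A) d.

Definition W (l : R -> Prop) (k : nat) : Prop :=
  exists x, l x /\
    (((/2) ^ (S k) <= x <= (/2) ^ k) \/ (- (/2) ^ k <= x <= - (/2) ^ (S k))).

Definition W_at (l : R -> Prop) (a : R) : nat -> Prop :=
  W (fun x => l (x + a)).

Fixpoint count_window (Wset : nat -> Prop) (k N : nat) : nat :=
  match N with
  | O => O
  | S N' => count_window Wset k N' +
            (if excluded_middle_informative (Wset (k + S N')%nat) then 1 else 0)%nat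
  end.

(** Upper Banach density zero:
    limsup_{N→∞} sup_k #(W ∩ [k+1,k+N]) / N = 0, unfolded. *)
Definition upper_banach_density_zero (Wset : nat -> Prop) : Prop :=
  forall eps, 0 < eps -> exists N0 : nat, forall N : nat, (N0 <= N)%nat ->
    forall k : nat, INR (count_window Wset k N) <= eps * INR N.

Definition super_sparse_near (l : R -> Prop) (a : R) : Prop :=
  upper_banach_density_zero (W_at l a).

Definition l_uv (A2 A3 : R -> Prop) (u v : R) : R -> Prop :=
  fun x => A2 x /\ exists y, A3 y /\ x = u * y + v.

(* Main.v *)
(** The idea is to play entropy against an irrational rotation. Let [a = u b + v]
    and let [j] run over a window. Zooming in at scale [2^-j] replaces [(a, b)] by
    the orbit point [(2^j a, 3^(nu j) b)] modulo 1 with [3^(nu j)] comparable to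
    [2^j], and the slope [u] by [(u / 3) 3^(theta j)], where [theta j] is the orbit
    of the rotation by [log 2 / log 3]. If [j] belongs to the sparse index, the line
    through the orbit point with this slope meets a translate of [A2 x A3] again at
    distance about 1, so at resolution [2^-m] the angle [theta j] is determined by
    the next [m] digits of the orbit point and by one of about [2^(s m)] cells, for
    some [s < 1], since the dimensions add up to less than 1. Angles being
    equidistributed, they carry [m] bits; if indices of the sparse index had
    positive density, the digits would thus reveal a positive proportion [c m] of
    them. A word of length [Q m] is made of [Q] words of length [m], each of which
    reveals the same angle up to a known rotation; subadditivity gives
    [H(Q m) <= m + Q (H(m) - c m + O(1))] for the entropy [H] of words. For large
    fixed [Q], the ratio [H(m) / m] drops by a fixed amount when [m] is replaced by
    [Q m], which cannot happen arbitrarily often as it is nonnegative. Everything is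
    finite: the entropies are those of a uniform time in the window, made cyclic so
    that shifts preserve the distribution. *)

Require Import Defs.
From Stdlib Require Import Reals ZArith Lra Lia Classical ClassicalEpsilon List.
From mathcomp Require all_boot all_order all_algebra zify ring lra reals exp Rstruct.
Open Scope R_scope.

(** * Covering numbers of invariant sets of small dimension *)

Lemma functional_choice {A B : Type} (P : A -> B -> Prop) :
  (forall x, exists y, P x y) -> exists f, forall x, P x (f x).
Proof.
  intros H.
  exists (fun x => proj1_sig (constructive_indefinite_description _ (H x))).
  intros x. apply proj2_sig.
Qed.

Lemma Int_part_unique (x : R) (z : Z) :
  IZR z <= x < IZR z + 1 -> Int_part x = z.
Proof.
  intros H. unfold Int_part. rewrite <- (tech_up x (z + 1)).
  - lia.
  - rewrite plus_IZR; lra.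
  - rewrite plus_IZR; lra.
Qed.

Lemma Int_part_bounds (x : R) : IZR (Int_part x) <= x < IZR (Int_part x) + 1.
Proof. destruct (base_Int_part x); lra. Qed.

Lemma frac_part_bounds (x : R) : 0 <= frac_part x < 1.
Proof. destruct (base_fp x); lra. Qed.

Lemma frac_part_add_IZR (x : R) (z : Z) : frac_part (x + IZR z) = frac_part x.
Proof.
  unfold frac_part. rewrite (Int_part_unique (x + IZR z) (Int_part x + z)).
  - rewrite plus_IZR; ring.
  - rewrite plus_IZR. pose proof (Int_part_bounds x); lra.
Qed.

Lemma frac_part_mul_frac (n : nat) (x : R) :
  frac_part (INR n * frac_part x) = frac_part (INR n * x).
Proof.
  rewrite <- (frac_part_add_IZR (INR n * frac_part x) (Z.of_nat n * Int_part x)).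
  f_equal. rewrite mult_IZR, <- INR_IZR_INZ. unfold frac_part; ring.
Qed.

Lemma times_p_invariant_pow (p : nat) (A : R -> Prop) :
  times_p_invariant p A ->
  forall (k : nat) (x : R), (1 <= k)%nat -> A x -> A (frac_part (INR p ^ k * x)).
Proof.
  intros HA k x Hk Ax. induction k as [|[|k] IH]; [lia| |].
  - rewrite pow_1. now apply HA.
  - simpl in IH |- *. rewrite Rmult_assoc, <- frac_part_mul_frac.
    apply HA, IH. lia.
Qed.

(** [compact] speaks of families indexed by reals, so ball number [n] gets the index [INR n]. A
    finite list of such indices is bounded, which yields [M]. *)
Lemma finite_subcover (A : R -> Prop) (c r : nat -> R) :
  compact A -> (forall x, A x -> exists n, Rabs (x - c n) < r n) ->
  exists M, forall x, A x -> exists n, (n <= M)%nat /\ Rabs (x - c n) < r n.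
Proof.
  intros HA Hc.
  assert (Hf : forall y : R,
    (exists x : R, exists n, y = INR n /\ Rabs (x - c n) < r n) ->
    exists n, y = INR n) by (intros y (x & n & Hn & _); now exists n).
  destruct (HA (mkfamily (fun y => exists n, y = INR n)
    (fun y x => exists n, y = INR n /\ Rabs (x - c n) < r n) Hf))
    as (D & Dcov & l & Hl).
  - split.
    + intros x Ax. destruct (Hc x Ax) as [n Hn]. exists (INR n), n. now split.
    + intros y x (n & Hy & Hn).
      assert (Hd : 0 < r n - Rabs (x - c n)) by lra.
      exists (mkposreal _ Hd). intros z Hz. exists n. split; [exact Hy|].
      unfold disc in Hz; simpl in Hz.
      replace (z - c n) with ((z - x) + (x - c n)) by ring.
      eapply Rle_lt_trans; [apply Rabs_triang|lra].
  - assert (HM : exists M, forall n, In (INR n) l -> (n <= M)%nat).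
    { clear Hl. induction l as [|y l [M IH]].
      - exists O. intros n [].
      - destruct (INR_unbounded y) as [M' HM']. exists (max M M').
        intros n [Hn|Hn].
        + subst y. apply INR_lt in HM'. lia.
        + apply IH in Hn. lia. }
    destruct HM as [M HM]. exists M. intros x Ax.
    destruct (Dcov x Ax) as (y & (n & Hy & Hn) & Dy).
    exists n. split; [|exact Hn]. apply HM. rewrite <- Hy. apply Hl.
    split; [now exists n|exact Dy].
Qed.

Lemma pow_scale_exists (P rho : R) : 2 <= P -> 0 < rho <= / P ->
  exists k, (1 <= k)%nat /\ P ^ k * rho <= 1 < P ^ S k * rho.
Proof.
  intros HP [H0 H1].
  assert (Hex : exists k, 1 < P ^ k * rho).
  { destruct (Pow_x_infinity P) with (b := / rho + 1) as [N HN].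
    - rewrite Rabs_pos_eq; lra.
    - exists N. specialize (HN N (le_n N)).
      rewrite Rabs_pos_eq in HN by (apply pow_le; lra).
      apply Rmult_lt_reg_r with (/ rho); [now apply Rinv_0_lt_compat|].
      rewrite Rmult_assoc, Rinv_r by lra. lra. }
  assert (H1' : P ^ 1 * rho <= 1).
  { apply Rmult_le_reg_l with (/ P); [apply Rinv_0_lt_compat; lra|].
    rewrite pow_1, <- Rmult_assoc, Rinv_l; lra. }
  destruct Hex as [k Hk]. induction k as [|k IH].
  - assert (P ^ 0 * rho <= P ^ 1 * rho) by
      (apply Rmult_le_compat_r; [lra|]; rewrite pow_1; simpl; lra). lra.
  - destruct (Rle_lt_dec (P ^ k * rho) 1) as [Hle|Hlt]; [|now apply IH].
    exists k. split; [|split; assumption].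
    destruct k; [exfalso; lra|lia].
Qed.

(** Multiplication by [p^k] sends the piece of [A] near [c] into [A] modulo 1. On that piece the
    integer part of [p^k x] differs from that of [p^k c] by at most 2, so five inverse branches pull
    the cover back, each dividing distances by [p^k]. *)
Lemma pullback_cover (p : nat) (A : R -> Prop) (r : R) (k : nat) (c rho : R)
    (l : list R) :
  (2 <= p)%nat -> times_p_invariant p A -> (1 <= k)%nat ->
  INR p ^ k * rho <= 1 ->
  (forall x, A x -> exists y, In y l /\ Rabs (x - y) <= INR p ^ k * r) ->
  exists l', (length l' <= 5 * length l)%nat /\
    forall x, A x -> Rabs (x - c) < 2 * rho ->
      exists y, In y l' /\ Rabs (x - y) <= r.
Proof.
  intros Hp HA Hk Hrho Hl.
  assert (HP : 0 < INR p ^ k) by (apply pow_lt, lt_0_INR; lia).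
  set (P := INR p ^ k) in *.
  set (z0 := Int_part (P * c)).
  set (g := fun e y => (y + IZR (z0 + e)) / P).
  exists (flat_map (fun e => map (g e) l) (-2 :: -1 :: 0 :: 1 :: 2 :: nil)%Z).
  split.
  - simpl. rewrite !length_app, !length_map. simpl. lia.
  - intros x Ax Hx.
    destruct (Hl _ (times_p_invariant_pow p A HA k x Hk Ax)) as (y & Hy & Hxy).
    fold P in Hxy. set (e := (Int_part (P * x) - z0)%Z).
    exists (g e y). split.
    + apply in_flat_map. exists e. split; [|now apply in_map].
      assert (He : Rabs (P * x - P * c) < 2).
      { rewrite <- Rmult_minus_distr_l, Rabs_mult, (Rabs_pos_eq P) by lra.
        eapply Rlt_le_trans; [apply Rmult_lt_compat_l; eauto|lra]. }
      apply Rabs_def2 in He.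
      pose proof (Int_part_bounds (P * x)) as B1.
      pose proof (Int_part_bounds (P * c)) as B2. fold z0 in B2.
      assert (E1 : (e < 3)%Z) by (apply lt_IZR; unfold e; rewrite minus_IZR; lra).
      assert (E2 : (-3 < e)%Z) by (apply lt_IZR; unfold e; rewrite minus_IZR; lra).
      assert (e = -2 \/ e = -1 \/ e = 0 \/ e = 1 \/ e = 2)%Z as HE by lia.
      simpl. intuition.
    + unfold g. replace (z0 + e)%Z with (Int_part (P * x)) by (unfold e; lia).
      replace (x - (y + IZR (Int_part (P * x))) / P)
        with ((frac_part (P * x) - y) / P) by (unfold frac_part; field; lra).
      unfold Rdiv. rewrite Rabs_mult, (Rabs_pos_eq (/ P))
        by (left; now apply Rinv_0_lt_compat).
      apply Rmult_le_reg_r with P; [lra|].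
      rewrite Rmult_assoc, Rinv_l by lra. lra.
Qed.

Lemma union_cover (A : R -> Prop) (r : R) (B : nat -> R -> Prop) (b : nat -> R)
    (M : nat) :
  (forall n, (n <= M)%nat -> exists l, INR (length l) <= b n /\
    forall x, A x -> B n x -> exists y, In y l /\ Rabs (x - y) <= r) ->
  exists l, INR (length l) <= sum_f_R0 b M /\
    forall x n, A x -> (n <= M)%nat -> B n x ->
      exists y, In y l /\ Rabs (x - y) <= r.
Proof.
  induction M as [|M IH]; intros H.
  - destruct (H O (le_n 0)) as (l & Hl & Hc). exists l. split; [exact Hl|].
    intros x n Ax Hn. replace n with O by lia. now apply Hc.
  - destruct IH as (l & Hl & Hc); [intros n Hn; apply H; lia|].
    destruct (H (S M) (le_n _)) as (l' & Hl' & Hc').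
    exists (l ++ l'). split.
    + rewrite length_app, plus_INR. simpl. lra.
    + intros x n Ax Hn Bx.
      destruct (Nat.eq_dec n (S M)) as [->|Hne].
      * destruct (Hc' x Ax Bx) as (y & Hy & Hxy). exists y.
        split; [apply in_or_app; now right|exact Hxy].
      * destruct (Hc x n Ax) as (y & Hy & Hxy); [lia|exact Bx|]. exists y.
        split; [apply in_or_app; now left|exact Hxy].
Qed.

Lemma unit_interval_cover (r : R) : 0 < r ->
  exists l, forall x, 0 <= x <= 1 -> exists y, In y l /\ Rabs (x - y) <= r.
Proof.
  intros Hr. destruct (INR_unbounded (/ r)) as [K HK].
  exists (map (fun i => INR i * r) (seq 0 (S K))). intros x Hx.
  assert (Hxr : 0 <= x / r) by (apply Rle_mult_inv_pos; lra).
  pose proof (Int_part_bounds (x / r)) as B.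
  set (z := Int_part (x / r)) in *.
  assert (Hz : (-1 < z)%Z) by (apply lt_IZR; lra).
  assert (Ez : IZR z = INR (Z.to_nat z)) by (rewrite INR_IZR_INZ, Z2Nat.id; [easy|lia]).
  assert (Ex : x = x / r * r) by (field; lra).
  assert (Hxr' : x / r <= / r).
  { unfold Rdiv. rewrite <- (Rmult_1_l (/ r)) at 2.
    apply Rmult_le_compat_r; [left; now apply Rinv_0_lt_compat|lra]. }
  exists (INR (Z.to_nat z) * r). split.
  - apply (in_map (fun i => INR i * r)). apply in_seq.
    assert (Z.to_nat z < S K)%nat; [|lia].
    apply INR_lt. rewrite S_INR. lra.
  - rewrite <- Ez. rewrite Ex at 1.
    rewrite <- Rmult_minus_distr_r, Rabs_mult, (Rabs_pos_eq r) by lra.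
    apply Rle_trans with (1 * r); [|lra].
    apply Rmult_le_compat_r; [lra|]. apply Rabs_le. lra.
Qed.

Lemma positive_lower_bound (r : nat -> R) (M : nat) :
  (forall n, 0 < r n) -> exists r0, 0 < r0 /\ forall n, (n <= M)%nat -> r0 <= r n.
Proof.
  intros H. induction M as [|M (r0 & H0 & IH)].
  - exists (r O). split; [apply H|]. intros n Hn. replace n with O by lia. lra.
  - exists (Rmin r0 (r (S M))). split; [now apply Rmin_pos|].
    intros n Hn. destruct (Nat.eq_dec n (S M)) as [->|Hne].
    + apply Rmin_r.
    + eapply Rle_trans; [apply Rmin_l|apply IH; lia].
Qed.

Lemma Rpower_neg_ge_1 (r s : R) : 0 < r <= 1 -> 0 <= s -> 1 <= Rpower r (- s).
Proof.
  intros Hr Hs. unfold Rpower. rewrite <- exp_0.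
  assert (ln r <= 0).
  { rewrite <- ln_1. destruct (Req_dec r 1) as [->|]; [lra|].
    left. apply ln_increasing; lra. }
  assert (0 <= - s * ln r) as [Hlt|<-]; [nra|left; now apply exp_increasing|lra].
Qed.

(* Cover [A] by finitely many sets [U n] of size [r n], with the sum of the
   [r n ^ s] tiny. An expanding power of the map carries [A] cut by [U n] into
   [A] while stretching it to unit size, so a cover of [A] at scale [rho / r n]
   pulls back to a cover of that piece at scale [rho]: this is an induction on
   scales. *)
Lemma Hnull_covering_number (p : nat) (A : R -> Prop) (s : R) :
  (2 <= p)%nat -> closed_set A -> (forall x, A x -> 0 <= x <= 1) ->
  times_p_invariant p A -> 0 <= s -> Hnull s A ->
  exists C, 0 < C /\ forall r, 0 < r <= 1 ->
    exists l, INR (length l) <= C * Rpower r (- s) /\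
      forall x, A x -> exists y, In y l /\ Rabs (x - y) <= r.
Proof.
  intros Hp Hcl H01 HA Hs HN.
  assert (HP : 2 <= INR p) by (change 2 with (INR 2); now apply le_INR).
  set (P := INR p) in *.
  assert (HPs : 0 < Rpower P s) by apply exp_pos.
  (* The bound on the sum is the inverse of the loss in one induction step: 5 inverse branches, and
     [P^s] because stretched pieces have size only between [1 / P] and 1. The same [C] then survives
     every step. Sizes at most [1 / P] leave room for at least one power of the map. *)
  destruct (HN (/ P) (/ (5 * Rpower P s))) as (U & r & Hr & Hd & HU & Hsum);
    [apply Rinv_0_lt_compat; lra|apply Rinv_0_lt_compat; lra|].
  destruct (functional_choice
    (fun n c => forall x, U n x -> A x -> U n c /\ A c)) as [c Hc].
  { intros n. destruct (classic (exists x, U n x /\ A x)) as [[x Hx]|Hno].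
    - now exists x.
    - exists 0. intros x Ux Ax. exfalso. apply Hno. now exists x. }
  assert (HA' : compact A).
  { apply compact_P5; [exact Hcl|]. exists 0, 1. exact H01. }
  destruct (finite_subcover A c (fun n => 2 * r n) HA') as [M HM].
  { intros x Ax. destruct (HU x Ax) as [n Hn]. exists n.
    specialize (Hd n x (c n) Hn (proj1 (Hc n x Hn Ax))). specialize (Hr n). lra. }
  destruct (positive_lower_bound r M) as (r0 & Hr0 & Hmin); [intros; apply Hr|].
  destruct (unit_interval_cover r0 Hr0) as [l0 Hl0].
  set (C := INR (length l0) + 1).
  assert (HC : 0 < C) by (pose proof (pos_INR (length l0)); unfold C; lra).
  exists C. split; [exact HC|].
  assert (Hcoarse : forall rho, 0 < rho <= 1 -> r0 <= rho ->
    exists l, INR (length l) <= C * Rpower rho (- s) /\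
      forall x, A x -> exists y, In y l /\ Rabs (x - y) <= rho).
  { intros rho Hrho Hle. exists l0. split.
    - pose proof (Rpower_neg_ge_1 rho s Hrho Hs).
      assert (C * 1 <= C * Rpower rho (- s)) by (apply Rmult_le_compat_l; lra).
      unfold C in *; lra.
    - intros x Ax. destruct (Hl0 x (H01 x Ax)) as (y & Hy & Hxy).
      exists y. split; [exact Hy|lra]. }
  (* Induction on the number [n] of factors [P] between [rho] and the coarse scale [r0]. The piece
     of size [r i] asks for a cover at scale [P ^ k * rho] with [k >= 1], which is at most 1 because
     [rho < r0 <= r i]. *)
  assert (Hmain : forall n rho, 0 < rho <= 1 -> r0 <= P ^ n * rho ->
    exists l, INR (length l) <= C * Rpower rho (- s) /\
      forall x, A x -> exists y, In y l /\ Rabs (x - y) <= rho).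
  { induction n as [|n IH]; intros rho Hrho Hle.
    - apply Hcoarse; [exact Hrho|simpl in Hle; lra].
    - destruct (Rle_lt_dec r0 rho) as [Hge|Hlt]; [now apply Hcoarse|].
      destruct (union_cover A rho (fun n x => Rabs (x - c n) < 2 * r n)
        (fun n => Rpower (r n) s * (5 * C * Rpower rho (- s) * Rpower P s)) M)
        as (l & Hl & Hcov).
      + intros i Hi. pose proof (Hr i) as Hri.
        destruct (pow_scale_exists P (r i) HP Hri) as (k & Hk & Hk1 & Hk2).
        assert (HPk : 0 < P ^ k) by (apply pow_lt; lra).
        assert (HPn : 0 < P ^ n) by (apply pow_lt; lra).
        destruct (IH (P ^ k * rho)) as (l & Hl & Hcov).
        * split; [apply Rmult_lt_0_compat; lra|].
          apply Rle_trans with (P ^ k * r i); [|exact Hk1].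
          apply Rmult_le_compat_l; [lra|]. specialize (Hmin i Hi). lra.
        * eapply Rle_trans; [exact Hle|].
          replace (P ^ S n * rho) with (P ^ n * (P ^ 1 * rho)) by (simpl; ring).
          apply Rmult_le_compat_l; [lra|].
          apply Rmult_le_compat_r; [lra|]. apply Rle_pow; [lra|exact Hk].
        * destruct (pullback_cover p A rho k (c i) (r i) l Hp HA Hk Hk1 Hcov)
            as (l' & Hl' & Hcov').
          exists l'. split; [|exact Hcov'].
          apply le_INR in Hl'. rewrite mult_INR in Hl'.
          replace (INR 5) with 5 in Hl' by (simpl; ring).
          eapply Rle_trans; [exact Hl'|].
          apply Rle_trans with (5 * (C * Rpower (P ^ k * rho) (- s))); [lra|].
          rewrite <- Rpower_mult_distr by lra.
          assert (Hpow : Rpower (P ^ k) (- s) <= Rpower (r i) s * Rpower P s).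
          { rewrite Rpower_mult_distr by lra.
            replace (Rpower (P ^ k) (- s)) with (Rpower (/ P ^ k) s).
            - apply Rle_Rpower_l; [lra|].
              split; [now apply Rinv_0_lt_compat|].
              apply Rmult_le_reg_l with (P ^ k); [exact HPk|].
              rewrite Rinv_r by lra. simpl in Hk2. lra.
            - unfold Rpower. rewrite ln_Rinv by exact HPk. f_equal. ring. }
          assert (0 < Rpower rho (- s)) by apply exp_pos.
          apply Rle_trans with
            (5 * (C * (Rpower (r i) s * Rpower P s * Rpower rho (- s)))); [|lra].
          apply Rmult_le_compat_l; [lra|]. apply Rmult_le_compat_l; [lra|].
          apply Rmult_le_compat_r; lra.
      + exists l. split.
        * eapply Rle_trans; [exact Hl|]. rewrite <- scal_sum.
          assert (0 < Rpower rho (- s)) by apply exp_pos.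
          apply Rle_trans with
            (5 * C * Rpower rho (- s) * Rpower P s * / (5 * Rpower P s)).
          -- apply Rmult_le_compat_l; [|apply Hsum].
             repeat apply Rmult_le_pos; lra.
          -- right. field. lra.
        * intros x Ax. destruct (HM x Ax) as (i & Hi & Hx). now apply (Hcov x i). }
  intros rho Hrho.
  destruct (Pow_x_infinity P) with (b := r0 / rho) as [n Hn].
  { rewrite Rabs_pos_eq; lra. }
  apply (Hmain n rho Hrho). specialize (Hn n (le_n n)).
  rewrite Rabs_pos_eq in Hn by (apply pow_le; lra).
  apply Rmult_le_reg_r with (/ rho); [apply Rinv_0_lt_compat; lra|].
  rewrite Rmult_assoc, Rinv_r by lra. unfold Rdiv in Hn. lra.
Qed.

(** * The rotation by log 2 / log 3 *)

Definition alpha : R := ln 2 / ln 3.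

Definition theta (j : nat) : R := frac_part (INR j * alpha).

(** The successor keeps the exponent of 3 positive, as [times_p_invariant_pow] requires. It is the
    source of the factor 3 in [Rpower_3_theta] and in the slopes below. *)
Definition nu (j : nat) : nat := S (Z.to_nat (Int_part (INR j * alpha))).

Definition cell (m j : nat) : nat := Z.to_nat (Int_part (2 ^ m * theta j)).

Lemma ln2_lt_ln3 : 0 < ln 2 < ln 3.
Proof.
  split; [rewrite <- ln_1|]; apply ln_increasing; lra.
Qed.

Lemma alpha_bounds : 0 < alpha < 1.
Proof.
  pose proof ln2_lt_ln3. unfold alpha. split.
  - apply Rdiv_lt_0_compat; lra.
  - apply Rmult_lt_reg_r with (ln 3); [lra|]. unfold Rdiv.
    rewrite Rmult_assoc, Rinv_l; lra.
Qed.

Lemma Int_part_nonneg (x : R) : 0 <= x -> (0 <= Int_part x)%Z.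
Proof.
  intros Hx. pose proof (Int_part_bounds x).
  assert (-1 < Int_part x)%Z; [apply lt_IZR; lra|lia].
Qed.

Lemma INR_Int_part (x : R) : 0 <= x ->
  INR (Z.to_nat (Int_part x)) = IZR (Int_part x).
Proof.
  intros Hx. rewrite INR_IZR_INZ, Z2Nat.id; [easy|now apply Int_part_nonneg].
Qed.

Lemma INR_mul_alpha_nonneg (j : nat) : 0 <= INR j * alpha.
Proof. pose proof alpha_bounds. apply Rmult_le_pos; [apply pos_INR|lra]. Qed.

Lemma theta_nu (j : nat) : INR j * alpha = theta j + INR (nu j) - 1.
Proof.
  unfold theta, nu, frac_part. rewrite S_INR, INR_Int_part; [ring|].
  apply INR_mul_alpha_nonneg.
Qed.

Lemma nu_S (j : nat) : nu (S j) = nu j \/ nu (S j) = S (nu j).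
Proof.
  pose proof (theta_nu j). pose proof (theta_nu (S j)) as H1.
  rewrite S_INR in H1. pose proof alpha_bounds.
  pose proof (frac_part_bounds (INR j * alpha)) as B0. fold (theta j) in B0.
  pose proof (frac_part_bounds (INR (S j) * alpha)) as B1. fold (theta (S j)) in B1.
  assert (nu (S j) < nu j + 2)%nat by
    (apply INR_lt; rewrite plus_INR; simpl (INR 2); lra).
  assert (nu j < nu (S j) + 1)%nat by
    (apply INR_lt; rewrite plus_INR; simpl (INR 1); lra).
  lia.
Qed.

Lemma Rpower_3_theta (j : nat) : Rpower 3 (theta j) * 3 ^ nu j = 3 * 2 ^ j.
Proof.
  pose proof ln2_lt_ln3.
  rewrite <- !Rpower_pow by lra.
  rewrite <- Rpower_plus.
  replace (theta j + INR (nu j)) with (1 + INR j * alpha)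
    by (rewrite theta_nu; ring).
  rewrite Rpower_plus, Rpower_1 by lra. f_equal.
  unfold Rpower, alpha. f_equal. field. lra.
Qed.

Lemma Rpower_3_theta_bounds (j : nat) : 1 <= Rpower 3 (theta j) < 3.
Proof.
  pose proof (frac_part_bounds (INR j * alpha)) as B. fold (theta j) in B.
  split.
  - rewrite <- (Rpower_O 3) by lra. apply Rle_Rpower; lra.
  - rewrite <- (Rpower_1 3) at 2 by lra. apply Rpower_lt; lra.
Qed.

Lemma cell_bounds (m j : nat) :
  INR (cell m j) <= 2 ^ m * theta j < INR (cell m j) + 1.
Proof.
  pose proof (frac_part_bounds (INR j * alpha)) as B. fold (theta j) in B.
  assert (0 < 2 ^ m) by (apply pow_lt; lra).
  unfold cell. rewrite INR_Int_part by (apply Rmult_le_pos; lra).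
  apply Int_part_bounds.
Qed.

Lemma cell_lt (m j : nat) : (cell m j < 2 ^ m)%nat.
Proof.
  pose proof (frac_part_bounds (INR j * alpha)) as B. fold (theta j) in B.
  assert (0 < 2 ^ m) by (apply pow_lt; lra).
  pose proof (cell_bounds m j). apply INR_lt. rewrite pow_INR.
  replace (INR 2) with 2 by (simpl; ring).
  assert (2 ^ m * theta j < 2 ^ m * 1) by (apply Rmult_lt_compat_l; lra). lra.
Qed.

Lemma cell_eq_close (m i j : nat) :
  cell m i = cell m j -> 2 ^ m * Rabs (theta i - theta j) < 1.
Proof.
  intros H. assert (0 < 2 ^ m) by (apply pow_lt; lra).
  pose proof (cell_bounds m i) as B1. pose proof (cell_bounds m j) as B2.
  rewrite H in B1. rewrite <- (Rabs_pos_eq (2 ^ m)), <- Rabs_mult by lra.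
  rewrite Rmult_minus_distr_l. apply Rabs_def1; lra.
Qed.

Lemma eq_mod_close (D a b : nat) :
  (a mod D = b mod D)%nat -> (a < b + D)%nat -> (b < a + D)%nat -> a = b.
Proof.
  intros H H1 H2. assert (D <> 0)%nat by lia.
  pose proof (Nat.div_mod_eq a D). pose proof (Nat.div_mod_eq b D).
  assert (a / D = b / D)%nat by nia. lia.
Qed.

(** Angles within [D] cells of each other have cell numbers differing by at most [D], and the
    residue modulo [D + 1] separates these. *)
Lemma cell_eq_of_close (m i j D : nat) :
  2 ^ m * Rabs (theta i - theta j) <= INR D ->
  (cell m i mod (S D) = cell m j mod (S D))%nat -> cell m i = cell m j.
Proof.
  intros H Hmod. assert (0 < 2 ^ m) by (apply pow_lt; lra).
  pose proof (cell_bounds m i) as B1. pose proof (cell_bounds m j) as B2.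
  rewrite <- (Rabs_pos_eq (2 ^ m)), <- Rabs_mult in H by lra.
  rewrite Rmult_minus_distr_l in H.
  assert (H' := Rle_abs (2 ^ m * theta i - 2 ^ m * theta j)).
  assert (H'' := Rle_abs (- (2 ^ m * theta i - 2 ^ m * theta j))).
  rewrite Rabs_Ropp in H''.
  apply (eq_mod_close (S D)); [exact Hmod| |];
    apply INR_lt; rewrite plus_INR, S_INR; lra.
Qed.

Lemma theta_add (j s : nat) :
  theta (j + s) =
    theta j + theta s - IZR (Int_part (theta j + theta s)).
Proof.
  unfold theta at 1. rewrite plus_INR, Rmult_plus_distr_r.
  replace (INR j * alpha + INR s * alpha)
    with (theta j + theta s + IZR (Int_part (INR j * alpha) + Int_part (INR s * alpha))).
  - rewrite frac_part_add_IZR. reflexivity.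
  - rewrite plus_IZR. unfold theta, frac_part. ring.
Qed.

(** The code holds the carry of [theta j + theta s] and the parity of the cell. With equal carries
    the shift is a translation, so equal shifted cells leave the angles less than one cell width
    apart, and the parity decides. *)
Lemma cell_shift_code (m s : nat) : exists c : nat -> nat,
  (forall j, (c j < 4)%nat) /\
  forall i j, cell m (i + s) = cell m (j + s) -> c i = c j -> cell m i = cell m j.
Proof.
  set (w := fun j => Z.to_nat (Int_part (theta j + theta s))).
  assert (Hw : forall j, (w j < 2)%nat /\ INR (w j) = IZR (Int_part (theta j + theta s))).
  { intros j.
    pose proof (frac_part_bounds (INR j * alpha)) as B0. fold (theta j) in B0.
    pose proof (frac_part_bounds (INR s * alpha)) as B1. fold (theta s) in B1.
    pose proof (Int_part_bounds (theta j + theta s)).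
    unfold w. rewrite INR_Int_part by lra. split; [|reflexivity].
    apply INR_lt. rewrite INR_Int_part by lra. simpl (INR 2). lra. }
  exists (fun j => 2 * w j + cell m j mod 2)%nat. split.
  - intros j. pose proof (Hw j). pose proof (Nat.mod_upper_bound (cell m j) 2). lia.
  - intros i j Hij Hc. pose proof (Hw i) as [Wi Ei]. pose proof (Hw j) as [Wj Ej].
    pose proof (Nat.mod_upper_bound (cell m i) 2).
    pose proof (Nat.mod_upper_bound (cell m j) 2).
    assert (Hw' : w i = w j) by lia.
    apply (cell_eq_of_close m i j 1); [|lia].
    apply cell_eq_close in Hij. rewrite !theta_add, <- Ei, <- Ej, Hw' in Hij.
    replace (theta i - theta j)
      with (theta i + theta s - INR (w j) - (theta j + theta s - INR (w j))) by ring.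
    simpl (INR 1). lra.
Qed.

Lemma pow2_neq_pow3 (d n : nat) : (1 <= d)%nat -> (2 ^ d <> 3 ^ n)%nat.
Proof.
  intros Hd H. assert (E : Nat.even (2 ^ d) = Nat.even (3 ^ n)) by now rewrite H.
  rewrite !Nat.even_pow in E by lia.
  destruct n as [|n]; [|rewrite Nat.even_pow in E by lia; discriminate].
  simpl in H. assert (2 ^ 1 <= 2 ^ d)%nat by (apply Nat.pow_le_mono_r; lia).
  simpl in *. lia.
Qed.

(** A rational value would make a power of 2 equal to a power of 3. *)
Lemma alpha_irrational (d : nat) (z : Z) : (1 <= d)%nat -> INR d * alpha <> IZR z.
Proof.
  intros Hd H. pose proof ln2_lt_ln3.
  assert (Hz : (0 <= z)%Z).
  { apply le_IZR. rewrite <- H. apply INR_mul_alpha_nonneg. }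
  assert (E : INR d * ln 2 = INR (Z.to_nat z) * ln 3).
  { rewrite INR_IZR_INZ with (n := Z.to_nat z), Z2Nat.id, <- H by exact Hz.
    unfold alpha. field. lra. }
  apply (pow2_neq_pow3 d (Z.to_nat z) Hd). apply INR_eq.
  rewrite !pow_INR. replace (INR 2) with 2 by (simpl; ring).
  replace (INR 3) with 3 by (simpl; ring).
  rewrite <- !Rpower_pow by lra. unfold Rpower. now rewrite E.
Qed.

Lemma cell_collision (m : nat) :
  exists i j, (i < j)%nat /\ cell m i = cell m j.
Proof.
  apply NNPP. intros Hno.
  set (l := map (cell m) (seq 0 (S (2 ^ m)))).
  assert (Hnd : NoDup l).
  { apply NoDup_map_NoDup_ForallPairs; [|apply seq_NoDup].
    intros i j _ _ Hij. destruct (Nat.lt_trichotomy i j) as [H|[H|H]];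
      [|exact H|]; exfalso; apply Hno; [exists i, j|exists j, i]; now split. }
  assert (Hincl : incl l (seq 0 (2 ^ m))).
  { intros c Hc. apply in_map_iff in Hc as (i & <- & _).
    apply in_seq. pose proof (cell_lt m i). lia. }
  pose proof (NoDup_incl_length Hnd Hincl) as Hlen.
  unfold l in Hlen. rewrite length_map, !length_seq in Hlen. lia.
Qed.

(** Two times in one cell give a [d] with [d * alpha] closer than [2^-m] to an integer, at a
    distance [delta > 0] by irrationality. The first multiple of [delta] beyond [2^-m] overshoots by
    at most [delta], hence stays below twice [2^-m]. *)
Lemma rotation_step (m : nat) : exists (q : nat) (z : Z),
  1 <= 2 ^ m * Rabs (INR q * alpha - IZR z) < 2.
Proof.
  assert (H2 : 0 < 2 ^ m) by (apply pow_lt; lra).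
  destruct (cell_collision m) as (i & j & Hij & Hc).
  apply cell_eq_close in Hc.
  set (d := (j - i)%nat).
  set (z := (Int_part (INR j * alpha) - Int_part (INR i * alpha))%Z).
  assert (Hd : theta j - theta i = INR d * alpha - IZR z).
  { unfold d, z, theta, frac_part. rewrite minus_IZR, minus_INR by lia. ring. }
  rewrite <- Rabs_Ropp, Ropp_minus_distr, Hd in Hc.
  set (delta := Rabs (INR d * alpha - IZR z)) in *.
  assert (Hdelta : 0 < delta).
  { apply Rabs_pos_lt. pose proof (alpha_irrational d z). unfold d in *.
    intros E. apply H; [lia|lra]. }
  assert (Hpos : 0 < 2 ^ m * delta) by now apply Rmult_lt_0_compat.
  set (y := / (2 ^ m * delta)).
  assert (Hy : y * (2 ^ m * delta) = 1) by (unfold y; apply Rinv_l; lra).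
  assert (Hy0 : 0 < y) by now apply Rinv_0_lt_compat.
  pose proof (INR_Int_part y (Rlt_le _ _ Hy0)) as Ec.
  pose proof (Int_part_bounds y) as Bc.
  set (c := S (Z.to_nat (Int_part y))).
  assert (Hc1 : y < INR c <= y + 1) by (unfold c; rewrite S_INR; lra).
  exists (c * d)%nat, (Z.of_nat c * z)%Z.
  rewrite mult_INR, mult_IZR, <- INR_IZR_INZ.
  replace (INR c * INR d * alpha - INR c * IZR z)
    with (INR c * (INR d * alpha - IZR z)) by ring.
  rewrite Rabs_mult, (Rabs_pos_eq (INR c)) by apply pos_INR. fold delta.
  replace (2 ^ m * (INR c * delta)) with (INR c * (2 ^ m * delta)) by ring.
  assert (y * (2 ^ m * delta) < INR c * (2 ^ m * delta))
    by (apply Rmult_lt_compat_r; lra).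
  assert (INR c * (2 ^ m * delta) <= (y + 1) * (2 ^ m * delta))
    by (apply Rmult_le_compat_r; lra).
  lra.
Qed.

Lemma NoDup_list_prod (A B : Type) (l : list A) (l' : list B) :
  NoDup l -> NoDup l' -> NoDup (list_prod l l').
Proof.
  intros Hl Hl'. induction Hl as [|a l Ha Hl IH]; simpl; [constructor|].
  apply NoDup_app; [|exact IH|].
  - apply NoDup_map_NoDup_ForallPairs; [|exact Hl'].
    intros x y _ _ E. now injection E.
  - intros [x y] H1 H2. apply in_map_iff in H1 as (b & E & _).
    injection E as -> ->. apply in_prod_iff in H2. tauto.
Qed.

(* With [q * alpha] at distance between [2^-m] and [2 * 2^-m] from the
   integers, the translates of the set of visits by [0, q, 2q, ...] (a quarter
   turn in total) are disjoint. *)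
Lemma cell_frequency (m : nat) : exists N0 : nat, forall (N k v : nat) (l : list nat),
  (N0 <= N)%nat -> NoDup l ->
  (forall j, In j l -> (j < N)%nat /\ cell m (k + j) = v) ->
  (length l * 2 ^ m <= 8 * N)%nat.
Proof.
  destruct (le_lt_dec 2 m) as [Hm|Hm].
  2:{ exists O. intros N k v l _ Hnd Hl.
      assert (Hincl : incl l (seq 0 N)).
      { intros j Hj. apply in_seq. apply Hl in Hj. lia. }
      apply NoDup_incl_length in Hincl; [|exact Hnd]. rewrite length_seq in Hincl.
      assert (2 ^ m <= 2 ^ 3)%nat by (apply Nat.pow_le_mono_r; lia).
      simpl in *. nia. }
  destruct (rotation_step m) as (q & z & Hq).
  set (K := (2 ^ (m - 2))%nat).
  assert (HK : (2 ^ m = 4 * K)%nat).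
  { unfold K. change 4%nat with (2 ^ 2)%nat. rewrite <- Nat.pow_add_r. f_equal. lia. }
  assert (HKR : 2 ^ m = 4 * INR K).
  { replace 2 with (INR 2) at 1 by (simpl; ring).
    rewrite <- pow_INR, HK, mult_INR. simpl (INR 4). ring. }
  (* For [N >= K * q] the [K] disjoint translates lie in [[0, 2 * N)]. As [2 ^ m = 4 * K], this
     gives the constant 8. *)
  exists (K * q)%nat. intros N k v l HN Hnd Hl.
  set (L := map (fun p => (fst p * q + snd p)%nat) (list_prod (seq 0 K) l)).
  assert (Hinj : forall i i' j j', (i < i')%nat -> (i' < K)%nat ->
    In j l -> In j' l -> (i * q + j <> i' * q + j')%nat).
  { intros i i' j j' Hi Hi' Hj Hj' E.
    apply Hl in Hj as [_ Hj]. apply Hl in Hj' as [_ Hj'].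
    rewrite <- Hj' in Hj. apply cell_eq_close in Hj.
    set (beta := INR q * alpha - IZR z) in *.
    assert (Ed : INR j - INR j' = (INR i' - INR i) * INR q).
    { apply (f_equal INR) in E. rewrite !plus_INR, !mult_INR in E. lra. }
    assert (Et : exists w : Z,
      theta (k + j) - theta (k + j') = (INR i' - INR i) * beta + IZR w).
    { exists ((Z.of_nat i' - Z.of_nat i) * z - Int_part (INR (k + j) * alpha)
              + Int_part (INR (k + j') * alpha))%Z.
      unfold beta, theta, frac_part.
      rewrite plus_IZR, minus_IZR, mult_IZR, minus_IZR, <- !INR_IZR_INZ, !plus_INR.
      replace (INR j) with (INR j' + (INR i' - INR i) * INR q) by lra. ring. }
    destruct Et as [w Ew]. rewrite Ew in Hj.
    assert (H1 : 1 <= INR i' - INR i).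
    { apply (le_INR (S i) i') in Hi. rewrite S_INR in Hi. lra. }
    assert (H2 : INR i' - INR i <= INR K - 1).
    { apply (le_INR (S i') K) in Hi'. rewrite S_INR in Hi'.
      pose proof (pos_INR i). lra. }
    set (x := INR i' - INR i) in *.
    (* Fewer than [K] steps turn by less than one half, so [x * beta] stays at distance at least
       [2^-m] from every integer, whereas visits to one cell differ by less. *)
    assert (B : 1 <= 2 ^ m * Rabs (x * beta) /\ Rabs (x * beta) < / 2).
    { rewrite Rabs_mult, (Rabs_pos_eq x) by lra.
      assert (0 <= Rabs beta) by apply Rabs_pos. split.
      - replace (2 ^ m * (x * Rabs beta)) with (x * (2 ^ m * Rabs beta)) by ring.
        apply Rle_trans with (1 * (2 ^ m * Rabs beta)); [lra|].
        apply Rmult_le_compat_r; lra.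
      - apply Rmult_lt_reg_l with (2 ^ m); [rewrite HKR; lra|].
        replace (2 ^ m * (x * Rabs beta)) with (x * (2 ^ m * Rabs beta)) by ring.
        apply Rle_lt_trans with (x * 2); [apply Rmult_le_compat_l; lra|].
        rewrite HKR. lra. }
    assert (H4 : 4 <= 2 ^ m) by (rewrite HKR; lra).
    destruct (Z.eq_dec w 0) as [->|Hw].
    - rewrite Rplus_0_r in Hj. lra.
    - assert (Hw1 : 1 <= Rabs (IZR w)).
      { rewrite <- abs_IZR. apply IZR_le. lia. }
      assert (Rabs (IZR w) <= Rabs (x * beta + IZR w) + Rabs (x * beta)).
      { replace (IZR w) with ((x * beta + IZR w) + - (x * beta)) at 1 by ring.
        rewrite <- (Rabs_Ropp (x * beta)). apply Rabs_triang. }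
      assert (/ 2 < Rabs (x * beta + IZR w)) by lra. nra. }
  assert (HndL : NoDup L).
  { apply NoDup_map_NoDup_ForallPairs.
    - intros [i j] [i' j'] Hp Hp' E. simpl in E.
      apply in_prod_iff in Hp as [Hi Hj], Hp' as [Hi' Hj'].
      apply in_seq in Hi, Hi'.
      destruct (Nat.lt_trichotomy i i') as [H|[H|H]].
      + exfalso. now apply (Hinj i i' j j'); try lia.
      + subst i'. f_equal. lia.
      + exfalso. apply (Hinj i' i j' j); try lia; assumption.
    - apply NoDup_list_prod; [apply seq_NoDup|exact Hnd]. }
  assert (Hincl : incl L (seq 0 (N + K * q))).
  { intros y Hy. apply in_map_iff in Hy as ([i j] & <- & Hp). simpl.
    apply in_prod_iff in Hp as [Hi Hj]. apply in_seq in Hi. apply Hl in Hj as [Hj _].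
    apply in_seq. nia. }
  apply NoDup_incl_length in Hincl; [|exact HndL].
  unfold L in Hincl. rewrite length_map, length_prod, !length_seq in Hincl.
  rewrite HK. nia.
Qed.

(** * Slices seen along the orbit *)

Definition orbit2 (a : R) (j : nat) : R := frac_part (2 ^ j * a).

Definition orbit3 (b : R) (j : nat) : R := frac_part (3 ^ nu j * b).

Definition digit2 (a : R) (j : nat) : nat := Z.to_nat (Int_part (2 * orbit2 a j)).

Definition digit3 (b : R) (j : nat) : nat := Z.to_nat (Int_part (3 * orbit3 b j)).

(** Tells whether a base 3 digit is consumed at time [j]. It is part of the alphabet, so that equal
    words consume base 3 digits at the same steps. *)
Definition jump (j : nat) : nat := (nu (S j) - nu j)%nat.

Lemma INR_digit (p : nat) (x : R) : 0 <= x < 1 ->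
  INR (Z.to_nat (Int_part (INR p * x))) = IZR (Int_part (INR p * x)).
Proof.
  intros Hx. apply INR_Int_part. apply Rmult_le_pos; [apply pos_INR|lra].
Qed.

Lemma digit_lt (p : nat) (x : R) : (1 <= p)%nat -> 0 <= x < 1 ->
  (Z.to_nat (Int_part (INR p * x)) < p)%nat.
Proof.
  intros Hp Hx. apply INR_lt. rewrite INR_digit by exact Hx.
  pose proof (Int_part_bounds (INR p * x)).
  apply (le_INR 1) in Hp. simpl (INR 1) in Hp.
  assert (INR p * x < INR p * 1) by (apply Rmult_lt_compat_l; lra). lra.
Qed.

Lemma digit2_lt (a : R) (j : nat) : (digit2 a j < 2)%nat.
Proof.
  unfold digit2. replace 2 with (INR 2) by (simpl; ring).
  apply digit_lt; [lia|apply frac_part_bounds].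
Qed.

Lemma digit3_lt (b : R) (j : nat) : (digit3 b j < 3)%nat.
Proof.
  unfold digit3. replace 3 with (INR 3) by (simpl; ring).
  apply digit_lt; [lia|apply frac_part_bounds].
Qed.

Lemma jump_lt (j : nat) : (jump j < 2)%nat.
Proof. unfold jump. pose proof (nu_S j). lia. Qed.

Lemma frac_part_mul_pow_S (p n : nat) (x : R) :
  frac_part (INR p ^ S n * x) =
    INR p * frac_part (INR p ^ n * x)
      - INR (Z.to_nat (Int_part (INR p * frac_part (INR p ^ n * x)))).
Proof.
  rewrite INR_digit by apply frac_part_bounds.
  simpl. rewrite Rmult_assoc, <- frac_part_mul_frac. reflexivity.
Qed.

Lemma orbit2_S (a : R) (j : nat) : orbit2 a (S j) = 2 * orbit2 a j - INR (digit2 a j).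
Proof.
  unfold orbit2, digit2. pose proof (frac_part_mul_pow_S 2 j a) as H.
  replace (INR 2) with 2 in H by (simpl; ring). exact H.
Qed.

Lemma orbit3_S (b : R) (j : nat) :
  nu (S j) = nu j /\ orbit3 b (S j) = orbit3 b j \/
  nu (S j) = S (nu j) /\ orbit3 b (S j) = 3 * orbit3 b j - INR (digit3 b j).
Proof.
  unfold digit3, orbit3. destruct (nu_S j) as [E|E]; rewrite E.
  - now left.
  - right. split; [reflexivity|].
    pose proof (frac_part_mul_pow_S 3 (nu j) b) as H.
    replace (INR 3) with 3 in H by (simpl; ring). exact H.
Qed.

Lemma orbit2_close (a : R) (m i j : nat) :
  (forall k, (k < m)%nat -> digit2 a (i + k) = digit2 a (j + k)) ->
  2 ^ m * Rabs (orbit2 a i - orbit2 a j) <= 1.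
Proof.
  revert i j. induction m as [|m IH]; intros i j H.
  - pose proof (frac_part_bounds (2 ^ i * a)). pose proof (frac_part_bounds (2 ^ j * a)).
    simpl. rewrite Rmult_1_l. apply Rabs_le. unfold orbit2. lra.
  - specialize (IH (S i) (S j)).
    assert (H0 : digit2 a i = digit2 a j)
      by (specialize (H O); rewrite !Nat.add_0_r in H; apply H; lia).
    rewrite !orbit2_S, H0 in IH.
    replace (2 * orbit2 a i - INR (digit2 a j) - (2 * orbit2 a j - INR (digit2 a j)))
      with (2 * (orbit2 a i - orbit2 a j)) in IH by ring.
    rewrite Rabs_mult, (Rabs_pos_eq 2) in IH by lra.
    simpl. rewrite (Rmult_comm 2), Rmult_assoc. apply IH.
    intros k Hk. simpl. rewrite !plus_n_Sm. apply H. lia.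
Qed.

(** A step with a jump triples the difference of the two points, a step without one keeps it; the
    growth of [nu] from [i] on counts the triplings. *)
Lemma orbit3_close_nu (b : R) (m i j : nat) :
  (forall k, (k < m)%nat ->
    digit3 b (i + k) = digit3 b (j + k) /\ jump (i + k) = jump (j + k)) ->
  3 ^ nu (i + m) * Rabs (orbit3 b i - orbit3 b j) <= 3 ^ nu i.
Proof.
  revert i j. induction m as [|m IH]; intros i j H.
  - rewrite Nat.add_0_r.
    pose proof (frac_part_bounds (3 ^ nu i * b)).
    pose proof (frac_part_bounds (3 ^ nu j * b)).
    assert (0 < 3 ^ nu i) by (apply pow_lt; lra).
    assert (Rabs (orbit3 b i - orbit3 b j) <= 1) by
      (apply Rabs_le; unfold orbit3; lra).
    rewrite <- (Rmult_1_r (3 ^ nu i)) at 2. apply Rmult_le_compat_l; lra.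
  - specialize (IH (S i) (S j)).
    assert (H0 : digit3 b i = digit3 b j /\ jump i = jump j)
      by (specialize (H O); rewrite !Nat.add_0_r in H; apply H; lia).
    destruct H0 as [H0 H1].
    replace (i + S m)%nat with (S i + m)%nat by lia.
    assert (IH' : 3 ^ nu (S i + m) * Rabs (orbit3 b (S i) - orbit3 b (S j))
      <= 3 ^ nu (S i)).
    { apply IH. intros k Hk. simpl. rewrite !plus_n_Sm. apply H. lia. }
    unfold jump in H1.
    destruct (orbit3_S b i) as [[Ni Ei]|[Ni Ei]], (orbit3_S b j) as [[Nj Ej]|[Nj Ej]];
      try (exfalso; lia); rewrite Ei, Ej, Ni in IH'.
    + exact IH'.
    + rewrite H0 in IH'.
      replace (3 * orbit3 b i - INR (digit3 b j) - (3 * orbit3 b j - INR (digit3 b j)))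
        with (3 * (orbit3 b i - orbit3 b j)) in IH' by ring.
      rewrite Rabs_mult, (Rabs_pos_eq 3) in IH' by lra.
      rewrite <- tech_pow_Rmult in IH'. lra.
Qed.

(** By [Rpower_3_theta] the expansion from [i] to [i + m] is [2^m] times the quotient of two powers
    [3^theta] in [[1, 3)], hence at least [2^m / 3]. *)
Lemma orbit3_close (b : R) (m i j : nat) :
  (forall k, (k < m)%nat ->
    digit3 b (i + k) = digit3 b (j + k) /\ jump (i + k) = jump (j + k)) ->
  2 ^ m * Rabs (orbit3 b i - orbit3 b j) <= 3.
Proof.
  intros H. apply orbit3_close_nu in H.
  pose proof (Rpower_3_theta i) as E0. pose proof (Rpower_3_theta (i + m)) as E1.
  pose proof (Rpower_3_theta_bounds i) as B0.
  pose proof (Rpower_3_theta_bounds (i + m)) as B1.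
  rewrite pow_add in E1.
  set (x := Rabs (orbit3 b i - orbit3 b j)) in *.
  assert (Hx : 0 <= x) by apply Rabs_pos.
  set (p := Rpower 3 (theta i)) in *. set (p' := Rpower 3 (theta (i + m))) in *.
  assert (H2 : 0 < 2 ^ i) by (apply pow_lt; lra).
  assert (Hn : 0 < 3 ^ nu i) by (apply pow_lt; lra).
  assert (H3 : 3 * 2 ^ i * (2 ^ m * x) <= 3 * 2 ^ i * 3).
  { replace (3 * 2 ^ i * (2 ^ m * x)) with (p' * (3 ^ nu (i + m) * x))
      by (rewrite <- Rmult_assoc, E1; ring).
    rewrite <- E0.
    apply Rle_trans with (p' * 3 ^ nu i); [apply Rmult_le_compat_l; lra|].
    replace (p * 3 ^ nu i * 3) with (p * 3 * 3 ^ nu i) by ring.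
    apply Rmult_le_compat_r; lra. }
  apply Rmult_le_reg_l in H3; [exact H3|lra].
Qed.

(** * From slopes of chords to angles *)

(** On nonnegative reals the derivative of [3^x] is at least [ln 3 >= 1], so closeness of slopes
    passes to angles without loss. *)
Lemma Rpower_3_expanding (s t : R) : 0 <= s -> 0 <= t ->
  Rabs (s - t) <= Rabs (Rpower 3 s - Rpower 3 t).
Proof.
  assert (Hmain : forall s t, 0 <= t <= s -> s - t <= Rpower 3 s - Rpower 3 t).
  { clear. intros s t H. pose proof ln2_lt_ln3.
    replace s with (t + (s - t)) at 2 by ring. rewrite Rpower_plus.
    assert (1 <= ln 3).
    { apply Rnot_lt_le. intros H'. apply exp_increasing in H'.
      rewrite exp_ln in H' by lra. pose proof exp_le_3. lra. }
    assert (E : 1 + (s - t) <= Rpower 3 (s - t)).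
    { unfold Rpower. pose proof (exp_ineq1_le ((s - t) * ln 3)).
      assert ((s - t) * 1 <= (s - t) * ln 3) by (apply Rmult_le_compat_l; lra). lra. }
    assert (E' : 1 <= Rpower 3 t).
    { rewrite <- (Rpower_O 3) by lra. apply Rle_Rpower; lra. }
    nra. }
  intros Hs Ht. destruct (Rle_lt_dec t s) as [H|H].
  - rewrite (Rabs_pos_eq (s - t)) by lra.
    eapply Rle_trans; [apply Hmain; lra|apply Rle_abs].
  - rewrite (Rabs_minus_sym s), (Rabs_minus_sym (Rpower 3 s)).
    rewrite (Rabs_pos_eq (t - s)) by lra.
    eapply Rle_trans; [apply Hmain; lra|apply Rle_abs].
Qed.

(* Two chords [(P2, P3)], [(P2', P3')] of slopes [u * 3^s / 3], [u * 3^t / 3]. *)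
Lemma slope_close (g u s t r P2 P3 P2' P3' : R) :
  0 < g -> g < Rabs u < / g -> 0 <= s < 1 -> 0 <= t < 1 -> 0 <= r ->
  / 2 <= Rabs P2 -> Rabs P2 <= 1 -> / 2 <= Rabs P2' ->
  3 * P2 = u * Rpower 3 s * P3 -> 3 * P2' = u * Rpower 3 t * P3' ->
  Rabs (P2 - P2') <= 3 * r -> Rabs (P3 - P3') <= 5 * r ->
  Rabs (s - t) <= 12 * (5 + 9 / g) / g ^ 3 * r.
Proof.
  intros Hg Hu Hs Ht Hr B1 B2 B3 E E' D2 D3.
  eapply Rle_trans; [apply Rpower_3_expanding; lra|].
  assert (Hpow : forall x, 0 <= x < 1 -> 1 <= Rpower 3 x < 3).
  { intros x Hx. split.
    - rewrite <- (Rpower_O 3) by lra. apply Rle_Rpower; lra.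
    - rewrite <- (Rpower_1 3) at 2 by lra. apply Rpower_lt; lra. }
  pose proof (Hpow s Hs) as Ps. pose proof (Hpow t Ht) as Pt.
  set (p := Rpower 3 s) in *. set (p' := Rpower 3 t) in *.
  assert (Hlow : forall w P Q, 1 <= w < 3 -> / 2 <= Rabs P ->
    3 * P = u * w * Q -> g / 2 <= Rabs Q).
  { intros w P Q Hw HP EQ. apply (f_equal Rabs) in EQ.
    rewrite !Rabs_mult, (Rabs_pos_eq 3), (Rabs_pos_eq w) in EQ by lra.
    assert (HQ : 0 <= Rabs Q) by apply Rabs_pos.
    assert (H1 : Rabs u * w * Rabs Q <= / g * 3 * Rabs Q).
    { apply Rmult_le_compat_r; [exact HQ|]. apply Rmult_le_compat; lra. }
    assert (H2 : / 2 <= / g * Rabs Q) by lra.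
    apply Rmult_le_reg_l with (/ g); [apply Rinv_0_lt_compat; lra|].
    replace (/ g * (g / 2)) with (/ 2) by (field; lra). exact H2. }
  pose proof (Hlow p P2 P3 Ps B1 E) as L1.
  pose proof (Hlow p' P2' P3' Pt B3 E') as L2.
  assert (U1 : Rabs P3 <= 3 / g).
  { apply (f_equal Rabs) in E.
    rewrite !Rabs_mult, (Rabs_pos_eq 3), (Rabs_pos_eq p) in E by lra.
    assert (HQ : 0 <= Rabs P3) by apply Rabs_pos.
    assert (g * 1 * Rabs P3 <= Rabs u * p * Rabs P3).
    { apply Rmult_le_compat_r; [exact HQ|]. apply Rmult_le_compat; lra. }
    apply Rmult_le_reg_l with g; [exact Hg|].
    replace (g * (3 / g)) with 3 by (field; lra). lra. }
  assert (Hig : 0 < / g) by now apply Rinv_0_lt_compat.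
  (* Cross-multiplying the two slope equations isolates [p - p']: the left side
     [3 * (P2 * P3' - P2' * P3)] is small since the chords are close, and the factor
     [|u| * |P3| * |P3'|] is at least [g ^ 3 / 4]. *)
  assert (Key : Rabs u * Rabs P3 * Rabs P3' * Rabs (p - p') <= 3 * (5 + 9 / g) * r).
  { rewrite <- !Rabs_mult.
    replace (u * P3 * P3' * (p - p')) with (3 * (P2 * (P3' - P3) + P3 * (P2 - P2'))).
    2:{ replace (u * P3 * P3' * (p - p'))
          with (u * p * P3 * P3' - u * p' * P3' * P3) by ring.
        rewrite <- E, <- E'. ring. }
    rewrite Rabs_mult, (Rabs_pos_eq 3) by lra.
    assert (H1 : Rabs (P2 * (P3' - P3)) <= 1 * (5 * r)).
    { rewrite Rabs_mult. apply Rmult_le_compat; try apply Rabs_pos; [exact B2|].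
      rewrite Rabs_minus_sym. exact D3. }
    assert (H2 : Rabs (P3 * (P2 - P2')) <= 3 / g * (3 * r)).
    { rewrite Rabs_mult. apply Rmult_le_compat; try apply Rabs_pos; assumption. }
    pose proof (Rabs_triang (P2 * (P3' - P3)) (P3 * (P2 - P2'))). unfold Rdiv in *. lra. }
  assert (Hprod : g * (g / 2) * (g / 2) <= Rabs u * Rabs P3 * Rabs P3').
  { apply Rmult_le_compat; [|lra| |exact L2].
    - apply Rmult_le_pos; lra.
    - apply Rmult_le_compat; lra. }
  assert (Hg3 : 0 < g ^ 3) by (apply pow_lt; lra).
  assert (g ^ 3 / 4 * Rabs (p - p') <= 3 * (5 + 9 / g) * r).
  { eapply Rle_trans; [|exact Key]. apply Rmult_le_compat_r; [apply Rabs_pos|].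
    replace (g ^ 3 / 4) with (g * (g / 2) * (g / 2)) by field. exact Hprod. }
  apply Rmult_le_reg_l with (g ^ 3 / 4); [lra|].
  replace (g ^ 3 / 4 * (12 * (5 + 9 / g) / g ^ 3 * r)) with (3 * (5 + 9 / g) * r)
    by (field; lra). assumption.
Qed.

(* The point of the slice at distance about [2^-j] from [a = u * b + v], seen at
   scale [2^-j]: [i2], [i3] locate its two coordinates in covers of [A2], [A3],
   and [n2], [n3] are (shifted) integer parts. *)
Definition chord (l2 l3 : list R) (B : nat) (r u a b : R) (j i2 i3 n2 n3 : nat)
    : Prop :=
  exists y2 y3, Rabs (y2 - nth i2 l2 0) <= r /\ Rabs (y3 - nth i3 l3 0) <= r /\
    / 2 <= Rabs (y2 - orbit2 a j + (INR n2 - 1)) <= 1 /\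
    3 * (y2 - orbit2 a j + (INR n2 - 1)) =
      u * Rpower 3 (theta j) * (y3 - orbit3 b j + (INR n3 - INR B)).

Lemma Rabs_le_inv (x y : R) : Rabs x <= y -> - y <= x <= y.
Proof. unfold Rabs. destruct (Rcase_abs x); lra. Qed.

(** Multiply [x = u * (b' - b)] by [3 * 2^j] and use [Rpower_3_theta]: [2^j x] and [3^nu j (b' - b)]
    have bounded size and are related by the slope. They agree modulo 1 with differences between
    points of [A2], [A3] and the orbit points, so the integers in between take finitely many values;
    adding 1 and [B] makes these natural numbers. *)
Lemma chord_exists (A2 A3 : R -> Prop) (l2 l3 : list R) (B : nat)
    (g r u v a b : R) (j : nat) :
  times_p_invariant 2 A2 -> times_p_invariant 3 A3 ->
  (forall x, A2 x -> exists y, In y l2 /\ Rabs (x - y) <= r) ->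
  (forall x, A3 x -> exists y, In y l3 /\ Rabs (x - y) <= r) ->
  0 < g -> g < Rabs u -> 3 / g + 1 < INR B -> a = u * b + v -> (1 <= j)%nat ->
  W_at (l_uv A2 A3 u v) a j ->
  exists i2 i3 n2 n3, (i2 < length l2)%nat /\ (i3 < length l3)%nat /\
    (n2 < 3)%nat /\ (n3 < 2 * B + 1)%nat /\ chord l2 l3 B r u a b j i2 i3 n2 n3.
Proof.
  intros HA2 HA3 H2 H3 Hg Hu HB Ha Hj (x & (Hx2 & b' & Hb' & Ex) & Hx).
  set (y2 := frac_part (2 ^ j * (x + a))). set (y3 := frac_part (3 ^ nu j * b')).
  assert (Ay2 : A2 y2).
  { pose proof (times_p_invariant_pow 2 A2 HA2 j (x + a) Hj Hx2) as H.
    replace (INR 2) with 2 in H by (simpl; ring). exact H. }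
  assert (Ay3 : A3 y3).
  { pose proof (times_p_invariant_pow 3 A3 HA3 (nu j) b' (le_n_S _ _ (Nat.le_0_l _)) Hb') as H.
    replace (INR 3) with 3 in H by (simpl; ring). exact H. }
  destruct (H2 y2 Ay2) as (c2 & Hc2 & D2). destruct (H3 y3 Ay3) as (c3 & Hc3 & D3).
  destruct (In_nth l2 c2 0 Hc2) as (i2 & Hi2 & <-).
  destruct (In_nth l3 c3 0 Hc3) as (i3 & Hi3 & <-).
  pose proof (frac_part_bounds (2 ^ j * (x + a))) as F2. fold y2 in F2.
  pose proof (frac_part_bounds (2 ^ j * a)) as F2'. fold (orbit2 a j) in F2'.
  pose proof (frac_part_bounds (3 ^ nu j * b')) as F3. fold y3 in F3.
  pose proof (frac_part_bounds (3 ^ nu j * b)) as F3'. fold (orbit3 b j) in F3'.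
  assert (P0 : 0 < 2 ^ j) by (apply pow_lt; lra).
  assert (Q0 : 0 < 3 ^ nu j) by (apply pow_lt; lra).
  set (z2 := (Int_part (2 ^ j * (x + a)) - Int_part (2 ^ j * a))%Z).
  set (z3 := (Int_part (3 ^ nu j * b') - Int_part (3 ^ nu j * b))%Z).
  assert (E2 : y2 - orbit2 a j + IZR z2 = 2 ^ j * x).
  { unfold y2, orbit2, z2, frac_part. rewrite minus_IZR. ring. }
  assert (E3 : y3 - orbit3 b j + IZR z3 = 3 ^ nu j * (b' - b)).
  { unfold y3, orbit3, z3, frac_part. rewrite minus_IZR. ring. }
  assert (E : 3 * (2 ^ j * x) = u * Rpower 3 (theta j) * (3 ^ nu j * (b' - b))).
  { replace (u * Rpower 3 (theta j) * (3 ^ nu j * (b' - b)))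
      with (Rpower 3 (theta j) * 3 ^ nu j * (u * (b' - b))) by ring.
    rewrite Rpower_3_theta. replace (u * (b' - b)) with x by lra. ring. }
  assert (Habs : / 2 <= Rabs (2 ^ j * x) <= 1).
  { rewrite Rabs_mult, (Rabs_pos_eq (2 ^ j)) by lra.
    assert (Hx' : (/ 2) ^ S j <= Rabs x <= (/ 2) ^ j).
    { assert (0 < (/ 2) ^ S j) by (apply pow_lt; lra).
      destruct Hx as [Hx|Hx]; [rewrite Rabs_pos_eq; lra|].
      rewrite Rabs_left by lra. lra. }
    assert (Einv : 2 ^ j * (/ 2) ^ j = 1).
    { rewrite <- Rpow_mult_distr, Rinv_r, pow1 by lra. reflexivity. }
    simpl (_ ^ S j) in Hx'. split.
    - replace (/ 2) with (2 ^ j * (/ 2 * (/ 2) ^ j)) at 1.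
      + apply Rmult_le_compat_l; lra.
      + replace (2 ^ j * (/ 2 * (/ 2) ^ j)) with (/ 2 * (2 ^ j * (/ 2) ^ j)) by ring.
        rewrite Einv. ring.
    - rewrite <- Einv. apply Rmult_le_compat_l; lra. }
  assert (Hz2 : (-2 < z2 < 2)%Z).
  { rewrite <- E2 in Habs. destruct Habs as [_ Hle].
    apply Rabs_le_inv in Hle. split; apply lt_IZR; lra. }
  assert (Hz3 : (- Z.of_nat B < z3 < Z.of_nat B)%Z).
  { pose proof (Rpower_3_theta_bounds j) as Bp.
    set (p := Rpower 3 (theta j)) in *.
    assert (Hle : Rabs (3 ^ nu j * (b' - b)) <= 3 / g).
    { apply (f_equal Rabs) in E.
      rewrite (Rabs_mult 3), (Rabs_mult (u * p)), (Rabs_mult u) in E.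
      rewrite (Rabs_pos_eq 3), (Rabs_pos_eq p) in E by lra.
      set (w := Rabs (3 ^ nu j * (b' - b))) in *.
      assert (0 <= w) by apply Rabs_pos.
      assert (g * 1 * w <= Rabs u * p * w).
      { apply Rmult_le_compat_r; [assumption|]. apply Rmult_le_compat; lra. }
      apply Rmult_le_reg_l with g; [exact Hg|].
      replace (g * (3 / g)) with 3 by (field; lra). lra. }
    rewrite <- E3 in Hle. apply Rabs_le_inv in Hle.
    split; apply lt_IZR; [rewrite opp_IZR|]; rewrite <- INR_IZR_INZ; lra. }
  exists i2, i3, (Z.to_nat (z2 + 1)), (Z.to_nat (z3 + Z.of_nat B)).
  repeat (split; [assumption || lia|]).
  exists y2, y3. split; [exact D2|]. split; [exact D3|].
  assert (EN2 : INR (Z.to_nat (z2 + 1)) - 1 = IZR z2).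
  { rewrite INR_IZR_INZ, Z2Nat.id, plus_IZR by lia. ring. }
  assert (EN3 : INR (Z.to_nat (z3 + Z.of_nat B)) - INR B = IZR z3).
  { rewrite INR_IZR_INZ, Z2Nat.id, plus_IZR, <- INR_IZR_INZ by lia. ring. }
  rewrite EN2, EN3, E2, E3. split; [exact Habs|exact E].
Qed.

(** Sharing cover indices puts the points of each set within [2 * r]; the orbit errors [r] and
    [3 * r] raise this to the [3 * r] and [5 * r] of [slope_close], while the common integers
    cancel. *)
Lemma chord_close (l2 l3 : list R) (B : nat) (g r u a b : R) (i j i2 i3 n2 n3 : nat) :
  0 < g -> g < Rabs u < / g -> 0 <= r ->
  Rabs (orbit2 a i - orbit2 a j) <= r -> Rabs (orbit3 b i - orbit3 b j) <= 3 * r ->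
  chord l2 l3 B r u a b i i2 i3 n2 n3 -> chord l2 l3 B r u a b j i2 i3 n2 n3 ->
  Rabs (theta i - theta j) <= 12 * (5 + 9 / g) / g ^ 3 * r.
Proof.
  intros Hg Hu Hr H2 H3 (y2 & y3 & D2 & D3 & B1 & E1) (y2' & y3' & D2' & D3' & B2 & E2).
  apply (slope_close g u (theta i) (theta j) r _ _ _ _ Hg Hu
    (frac_part_bounds _) (frac_part_bounds _) Hr (proj1 B1) (proj2 B1) (proj1 B2) E1 E2).
  - apply Rabs_le_inv in H2, D2, D2'. apply Rabs_le. lra.
  - apply Rabs_le_inv in H3, D3, D3'. apply Rabs_le. lra.
Qed.

Lemma pair_code_lt (x y a n : nat) :
  (x < a)%nat -> (y < n)%nat -> (x * n + y < a * n)%nat.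
Proof. nia. Qed.

Lemma pair_code_inj (x y x' y' n : nat) : (y < n)%nat -> (y' < n)%nat ->
  (x * n + y = x' * n + y')%nat -> x = x' /\ y = y'.
Proof.
  intros Hy Hy' E. rewrite !(Nat.mul_comm _ n) in E.
  now apply (Nat.div_mod_unique n x x' y y').
Qed.

(** Replaces the real exponent [s] by [1 - 1/q >= s] and takes [q]-th powers, so that the entropy
    argument handles natural numbers only; [D] exceeds [C ^ q]. *)
Lemma pow_bound_of_covering (s : R) (C : R) (q : nat) :
  0 <= s -> 0 <= C -> INR q * s <= INR q - 1 -> exists D : nat, forall m K : nat,
  INR K <= C * Rpower 2 (INR m * s) -> (K ^ q <= D * 2 ^ ((q - 1) * m))%nat.
Proof.
  intros Hs HC Hq. destruct (INR_unbounded (C ^ q)) as [D HD]. exists D.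
  assert (Hq1 : (1 <= q)%nat).
  { destruct q; [|lia]. simpl in Hq. lra. }
  intros m K HK. apply INR_le. rewrite pow_INR, mult_INR, pow_INR.
  replace (INR 2) with 2 by (simpl; ring).
  apply Rle_trans with ((C * Rpower 2 (INR m * s)) ^ q).
  { apply pow_incr. split; [apply pos_INR|exact HK]. }
  rewrite Rpow_mult_distr. apply Rmult_le_compat.
  - now apply pow_le.
  - apply pow_le. left. apply exp_pos.
  - lra.
  - rewrite <- !Rpower_pow by (try apply exp_pos; lra).
    rewrite Rpower_mult. apply Rle_Rpower; [lra|].
    rewrite mult_INR, minus_INR by exact Hq1. simpl (INR 1).
    pose proof (pos_INR m). nra.
Qed.

Lemma dimH_lt (A : R -> Prop) (d t : R) : is_dimH A d -> d < t ->
  exists s, 0 <= s < t /\ Hnull s A.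
Proof.
  intros [_ Hinf] Hdt. apply NNPP. intros Hno.
  apply (Rlt_not_le _ _ Hdt). apply Hinf. intros s [Hs HN].
  apply Rnot_lt_le. intros Hst. apply Hno. exists s. repeat split; assumption.
Qed.

(** The code of [j] consists of the indices of one chord and the residue of the cell modulo [E + 1].
    The next [m] digits and the chord fix the angle up to [E] cells, and the residue fixes the
    cell. *)
Lemma slice_coding (A2 A3 : R -> Prop) (g : R) :
  closed_set A2 -> closed_set A3 ->
  (forall x, A2 x -> 0 <= x <= 1) -> (forall x, A3 x -> 0 <= x <= 1) ->
  times_p_invariant 2 A2 -> times_p_invariant 3 A3 ->
  (exists d2 d3 : R, is_dimH A2 d2 /\ is_dimH A3 d3 /\ d2 + d3 < 1) -> 0 < g ->
  exists q D : nat, (1 <= q)%nat /\ forall m : nat, exists K : nat,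
    (K ^ q <= D * 2 ^ ((q - 1) * m))%nat /\
    forall u v a b : R, g < Rabs u < / g -> a = u * b + v ->
    exists d : nat -> nat, (forall j, (d j < K)%nat) /\
      forall i j, (1 <= i)%nat -> (1 <= j)%nat ->
      W_at (l_uv A2 A3 u v) a i -> W_at (l_uv A2 A3 u v) a j ->
      (forall k, (k < m)%nat -> digit2 a (i + k) = digit2 a (j + k) /\
        digit3 b (i + k) = digit3 b (j + k) /\ jump (i + k) = jump (j + k)) ->
      d i = d j -> cell m i = cell m j.
Proof.
  intros Hc2 Hc3 H01 H01' HA2 HA3 (d2 & d3 & Hd2 & Hd3 & Hd) Hg.
  (* Each set receives half of the gap [1 - d2 - d3], so that [s2 + s3 < 1]. *)
  destruct (dimH_lt A2 d2 (d2 + (1 - d2 - d3) / 2) Hd2) as (s2 & Hs2 & HN2); [lra|].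
  destruct (dimH_lt A3 d3 (d3 + (1 - d2 - d3) / 2) Hd3) as (s3 & Hs3 & HN3); [lra|].
  destruct (Hnull_covering_number 2 A2 s2 (le_n 2) Hc2 H01 HA2 (proj1 Hs2) HN2)
    as (C2 & HC2 & Hcov2).
  destruct (Hnull_covering_number 3 A3 s3 (le_S _ _ (le_n 2)) Hc3 H01' HA3
    (proj1 Hs3) HN3) as (C3 & HC3 & Hcov3).
  assert (Hs : 0 <= s2 + s3 < 1) by lra. set (s := s2 + s3) in *.
  destruct (INR_unbounded (/ (1 - s))) as [q Hq].
  destruct (INR_unbounded (3 / g + 1)) as [B HB].
  destruct (INR_unbounded (12 * (5 + 9 / g) / g ^ 3)) as [E HE].
  set (C := (C2 + 1) * (C3 + 1) * (3 * INR (2 * B + 1) * INR (S E))).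
  assert (HC : 0 <= C).
  { unfold C. repeat apply Rmult_le_pos; try apply pos_INR; lra. }
  assert (Hqs : INR q * s <= INR q - 1).
  { assert (/ (1 - s) * (1 - s) <= INR q * (1 - s))
      by (apply Rmult_le_compat_r; lra).
    rewrite Rinv_l in H by lra. lra. }
  destruct (pow_bound_of_covering s C q (proj1 Hs) HC Hqs) as [D HD].
  exists q, D. split.
  { destruct q; [|lia]. simpl in Hqs. lra. }
  intros m. set (r := / 2 ^ m).
  assert (P0 : 1 <= 2 ^ m) by (apply pow_R1_Rle; lra).
  assert (Hr : 0 < r <= 1).
  { split; [apply Rinv_0_lt_compat; lra|].
    unfold r. rewrite <- Rinv_1. apply Rinv_le_contravar; lra. }
  assert (Hrpow : forall t, Rpower r (- t) = Rpower 2 (INR m * t)).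
  { intros t. unfold r. rewrite <- Rpower_pow by lra.
    rewrite <- Rpower_Ropp, Rpower_mult. f_equal. ring. }
  destruct (Hcov2 r Hr) as (l2 & Hl2 & Hl2c). destruct (Hcov3 r Hr) as (l3 & Hl3 & Hl3c).
  (* The successors keep [K] positive even for empty covers, so that 0 can serve as default code at
     time 0 and outside the sparse index. *)
  set (K := (S (length l2) * S (length l3) * 3 * (2 * B + 1) * S E)%nat).
  exists K. split.
  { apply HD. unfold K, C, s.
    rewrite !(mult_INR _ (S E)), !(mult_INR _ (2 * B + 1)), !(mult_INR _ 3), mult_INR.
    rewrite (S_INR (length l2)), (S_INR (length l3)).
    rewrite (Rmult_plus_distr_l (INR m) s2 s3), Rpower_plus.
    rewrite Hrpow in Hl2, Hl3.
    assert (Hge1 : forall t, 0 <= t -> 1 <= Rpower 2 (INR m * t)).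
    { intros t Ht. rewrite <- Hrpow. now apply Rpower_neg_ge_1. }
    pose proof (Hge1 s2 (proj1 Hs2)). pose proof (Hge1 s3 (proj1 Hs3)).
    set (w2 := Rpower 2 (INR m * s2)) in *. set (w3 := Rpower 2 (INR m * s3)) in *.
    set (F := 3 * INR (2 * B + 1) * INR (S E)).
    assert (HF : 0 <= F).
    { unfold F. repeat apply Rmult_le_pos; try apply pos_INR; lra. }
    replace ((C2 + 1) * (C3 + 1) * F * (w2 * w3))
      with (((C2 + 1) * w2) * ((C3 + 1) * w3) * F) by ring.
    replace (INR 3) with 3 by (simpl; ring).
    replace ((INR (length l2) + 1) * (INR (length l3) + 1) * 3 * INR (2 * B + 1) * INR (S E))
      with ((INR (length l2) + 1) * (INR (length l3) + 1) * F) by (unfold F; ring).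
    apply Rmult_le_compat_r; [exact HF|].
    pose proof (pos_INR (length l2)). pose proof (pos_INR (length l3)).
    apply Rmult_le_compat; lra. }
  intros u v a b Hu Hab.
  set (Wj := W_at (l_uv A2 A3 u v) a).
  destruct (functional_choice (fun j n => (n < K)%nat /\ ((1 <= j)%nat -> Wj j ->
    exists i2 i3 n2 n3, (i3 < S (length l3))%nat /\ (n2 < 3)%nat /\
      (n3 < 2 * B + 1)%nat /\ chord l2 l3 B r u a b j i2 i3 n2 n3 /\
      n = ((((i2 * S (length l3) + i3) * 3 + n2) * (2 * B + 1) + n3) * S E
           + cell m j mod S E)%nat))) as [d Hdj].
  { intros j. destruct (classic ((1 <= j)%nat /\ Wj j)) as [[Hj HW]|Hno].
    - destruct (chord_exists A2 A3 l2 l3 B g r u v a b j HA2 HA3 Hl2c Hl3c Hg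
        (proj1 Hu) HB Hab Hj HW) as (i2 & i3 & n2 & n3 & Hi2 & Hi3 & Hn2 & Hn3 & Hch).
      eexists. split; [|intros _ _; exists i2, i3, n2, n3;
        exact (conj (Nat.lt_lt_succ_r _ _ Hi3) (conj Hn2 (conj Hn3 (conj Hch eq_refl))))].
      unfold K. repeat apply pair_code_lt; try lia. apply Nat.mod_upper_bound. lia.
    - exists O. split; [unfold K; lia|]. intros Hj HW. exfalso. now apply Hno. }
  exists d. split; [intros j; apply Hdj|].
  intros i j Hi Hj Wi Wj' Hdig Hd'.
  destruct (Hdj i) as [_ Hdi]. destruct (Hdj j) as [_ Hdj'].
  destruct (Hdi Hi Wi) as (i2 & i3 & n2 & n3 & B3 & N2 & N3 & Ch & Ei).
  destruct (Hdj' Hj Wj') as (i2' & i3' & n2' & n3' & B3' & N2' & N3' & Ch' & Ej).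
  rewrite Ei, Ej in Hd'.
  apply pair_code_inj in Hd' as [Hd' Hmod]; try (apply Nat.mod_upper_bound; lia).
  apply pair_code_inj in Hd' as [Hd' <-]; try assumption.
  apply pair_code_inj in Hd' as [Hd' <-]; try assumption.
  apply pair_code_inj in Hd' as [<- <-]; try assumption.
  apply (cell_eq_of_close m i j E); [|exact Hmod].
  assert (Er : 2 ^ m * r = 1) by (unfold r; apply Rinv_r; lra).
  assert (Hscale : forall x c, 2 ^ m * x <= c -> x <= c * r).
  { intros x c Hx. apply Rmult_le_reg_l with (2 ^ m); [lra|].
    replace (2 ^ m * (c * r)) with (c * (2 ^ m * r)) by ring. rewrite Er. lra. }
  assert (Hth : Rabs (theta i - theta j) <= 12 * (5 + 9 / g) / g ^ 3 * r).
  { apply (chord_close l2 l3 B g r u a b i j i2 i3 n2 n3 Hg Hu); try assumption; try lra.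
    - rewrite <- (Rmult_1_l r). apply Hscale, orbit2_close. intros k Hk. now apply Hdig.
    - apply Hscale, orbit3_close. intros k Hk. now apply Hdig. }
  apply Rle_trans with (2 ^ m * (12 * (5 + 9 / g) / g ^ 3 * r)).
  - apply Rmult_le_compat_l; lra.
  - replace (2 ^ m * (12 * (5 + 9 / g) / g ^ 3 * r))
      with (12 * (5 + 9 / g) / g ^ 3 * (2 ^ m * r)) by ring.
    rewrite Er. lra.
Qed.

(** * Density and frequency bounds in integers *)

(** The order of choices matters: [e] is about [2 / eps], and [M] comes later, from [entropy_core]
    applied to [e]. For [N] large the loss of [M] indices costs at most half of the count. *)
Lemma density_margin (eps : R) : 0 < eps -> exists e : nat, (1 <= e)%nat /\
  forall M : nat, exists N1 : nat, forall N n : nat, (N1 <= N)%nat ->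
    eps * INR N < INR n -> (N <= e * (n - M))%nat.
Proof.
  intros He. assert (Hi : 0 < / eps) by now apply Rinv_0_lt_compat.
  destruct (INR_unbounded (2 * / eps)) as [e Hee]. exists e. split.
  { destruct e; [simpl in Hee; lra|lia]. }
  intros M. destruct (INR_unbounded (2 * INR M * / eps)) as [N1 HN1]. exists N1.
  intros N n HN Hn. apply le_INR in HN.
  assert (H1 : 2 * INR M <= eps * INR N).
  { apply Rmult_le_reg_r with (/ eps); [exact Hi|].
    replace (eps * INR N * / eps) with (INR N) by (field; lra). lra. }
  assert (H2 : (M <= n)%nat).
  { apply INR_le. pose proof (pos_INR M). lra. }
  apply INR_le. rewrite mult_INR, minus_INR by exact H2.
  apply Rle_trans with (2 * / eps * (eps * INR N / 2)).
  - right. field. lra.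
  - apply Rmult_le_compat; try lra.
    pose proof (pos_INR M). lra.
Qed.

Lemma cell_frequency_uniform (M : nat) : exists N0 : nat,
  forall (m N k v : nat) (l : list nat), (m <= M)%nat -> (N0 <= N)%nat -> NoDup l ->
  (forall j, In j l -> (j < N)%nat /\ cell m (k + j) = v) ->
  (length l * 2 ^ m <= 8 * N)%nat.
Proof.
  induction M as [|M [N0 IH]].
  - destruct (cell_frequency 0) as [N0 H]. exists N0. intros m N k v l Hm.
    replace m with O by lia. apply H.
  - destruct (cell_frequency (S M)) as [N1 H]. exists (max N0 N1).
    intros m N k v l Hm HN. destruct (Nat.eq_dec m (S M)) as [->|Hne].
    + apply H. lia.
    + apply IH; lia.
Qed.

(** * Entropy of labellings of a finite set *)

Section Combinatorics.
Import all_boot all_order all_algebra zify ring lra reals exp Rstruct.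
Set Implicit Arguments.
Unset Strict Implicit.
Unset Printing Implicit Defensive.
Import Order.TTheory GRing.Theory Num.Theory.

Section Entropy.
Local Open Scope ring_scope.
Context {R : realType}.

Definition lb (x : R) : R := ln x / ln 2.

Lemma ln2_gt0 : 0 < ln (2 : R).
Proof. by apply: ln_gt0; lra. Qed.

Lemma lbM x y : 0 < x -> 0 < y -> lb (x * y) = lb x + lb y.
Proof. by move=> x0 y0; rewrite /lb lnM ?posrE // mulrDl. Qed.

Lemma lbV x : 0 < x -> lb x^-1 = - lb x.
Proof. by move=> x0; rewrite /lb lnV ?posrE // mulNr. Qed.

Lemma lbX x n : 0 < x -> lb (x ^+ n) = n%:R * lb x.
Proof. by move=> x0; rewrite /lb lnXn // -[ln x *+ n]mulr_natl mulrA. Qed.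

Lemma lb2 : lb 2 = 1.
Proof. by rewrite /lb divff // gt_eqF // ln2_gt0. Qed.

Lemma lb2X n : lb (2 ^+ n) = n%:R.
Proof. by rewrite lbX ?ltr0n // lb2 mulr1. Qed.

Lemma le_lb x y : 0 < x -> x <= y -> lb x <= lb y.
Proof.
move=> x0 xy; rewrite ler_pM2r ?invr_gt0 ?ln2_gt0 //.
by rewrite ler_ln ?posrE // (lt_le_trans x0).
Qed.

Lemma lb_ge0 x : 1 <= x -> 0 <= lb x.
Proof. by move=> x1; apply: divr_ge0; [exact: ln_ge0|exact: ltW ln2_gt0]. Qed.

Lemma lb_le_sub1 x : 0 < x -> lb x <= (x - 1) / ln 2.
Proof.
move=> x0; rewrite ler_pM2r ?invr_gt0 ?ln2_gt0 //.
by have := @le_ln1Dx R (x - 1); rewrite [1 + _]addrC subrK; apply; lra.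
Qed.

Context {Omega : finType}.

Definition fiber_card (T : eqType) (f : Omega -> T) (v : T) : nat :=
  #|[pred x | f x == v]|.

(** This is [#|Omega|] times the Shannon entropy, in bits, of the label of a uniform point. *)
Definition entropy (T : eqType) (f : Omega -> T) : R :=
  \sum_x lb (#|Omega|%:R / (fiber_card f (f x))%:R).

Lemma fiber_card_gt0 (T : eqType) (f : Omega -> T) x :
  (0 < fiber_card f (f x))%N.
Proof. by apply/card_gt0P; exists x; rewrite inE. Qed.

Lemma fiber_card_le (T : eqType) (f : Omega -> T) v :
  (fiber_card f v <= #|Omega|)%N.
Proof. exact: max_card. Qed.

Lemma Omega_gt0 (x : Omega) : 0 < #|Omega|%:R :> R.
Proof. by rewrite ltr0n; apply/card_gt0P; exists x. Qed.

Lemma entropy_ge0 (T : eqType) (f : Omega -> T) : 0 <= entropy f.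
Proof.
apply: sumr_ge0 => x _; apply: lb_ge0.
rewrite ler_pdivlMr ?ltr0n ?fiber_card_gt0 // mul1r ler_nat.
exact: fiber_card_le.
Qed.

Lemma entropy_refine (S T : eqType) (f : Omega -> S) (g : Omega -> T) :
  (forall x y, f x = f y -> g x = g y) -> entropy g <= entropy f.
Proof.
move=> fg; apply: ler_sum => x _; apply: le_lb.
  by rewrite divr_gt0 ?Omega_gt0 // ltr0n fiber_card_gt0.
rewrite ler_wpM2l ?ler0n // lef_pV2 ?posrE ?ltr0n ?fiber_card_gt0 //.
rewrite ler_nat; apply/subset_leq_card/subsetP => y; rewrite !inE.
by move=> /eqP /fg /eqP.
Qed.

(** Gibbs' inequality, by summing the tangent bound [lb q <= (q - 1) / ln 2]. *)
Lemma sum_lb_le0 (q : Omega -> R) : (forall x, 0 < q x) ->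
  \sum_x q x <= #|Omega|%:R -> \sum_x lb (q x) <= 0.
Proof.
move=> q0 hq; apply: (@le_trans _ _ (\sum_x (q x - 1) / ln 2)).
  by apply: ler_sum => x _; apply: lb_le_sub1.
rewrite -mulr_suml pmulr_lle0 ?invr_gt0 ?ln2_gt0 //.
by rewrite big_split /= sumrN sumr_const subr_le0.
Qed.

Lemma sum_fiber_card (T : finType) (f : Omega -> T) :
  \sum_v (fiber_card f v)%:R = #|Omega|%:R :> R.
Proof.
rewrite -natr_sum; congr (_%:R); rewrite -[RHS]sum1_card.
rewrite (partition_big f predT) //=; apply: eq_bigr => v _.
by rewrite sum1_card.
Qed.

Lemma sum_fiber_card_pair (S T : finType) (f : Omega -> S) (h : Omega -> T) c :
  \sum_a (fiber_card (fun x => (f x, h x)) (a, c))%:R = (fiber_card h c)%:R :> R.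
Proof.
rewrite -natr_sum; congr (_%:R); rewrite -[RHS]sum1_card.
rewrite (partition_big f predT) //=; apply: eq_bigr => v _.
by rewrite sum1_card; apply: eq_card => x; rewrite !inE xpair_eqE andbC.
Qed.

Lemma sum_over_fibers (T : finType) (f : Omega -> T) (phi : T -> R) :
  (forall v, 0 <= phi v) ->
  \sum_x phi (f x) / (fiber_card f (f x))%:R <= \sum_v phi v.
Proof.
move=> phi0; rewrite (partition_big f predT) //=; apply: ler_sum => v _.
rewrite (eq_bigr (fun=> phi v / (fiber_card f v)%:R)); last first.
  by move=> x /eqP ->.
have -> : \sum_(x | f x == v) phi v / (fiber_card f v)%:R =
  phi v / (fiber_card f v)%:R * (fiber_card f v)%:R :> R.
  by rewrite sumr_const mulr_natr.
have [->|n0] := eqVneq (fiber_card f v) 0%N; first by rewrite mulr0.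
by rewrite divfK // pnatr_eq0.
Qed.

(** [lb (kappa v)] acts as the length of a codeword for [v], and the second hypothesis is Kraft's
    inequality. Gibbs' inequality compares the fibres of the pair with the weights of [g] and the
    code. *)
Lemma entropy_pair_le (S T : finType) (g : Omega -> S) (f : Omega -> T)
    (kappa : T -> R) :
  (forall v, 0 < kappa v) -> \sum_v (kappa v)^-1 <= 1 ->
  entropy (fun x => (g x, f x)) <= entropy g + \sum_x lb (kappa (f x)).
Proof.
move=> k0 k1; set gf := fun x => _.
pose q x := (fiber_card g (g x))%:R / kappa (f x) / (fiber_card gf (gf x))%:R.
have gt0 (U : eqType) (h : Omega -> U) x : 0 < (fiber_card h (h x))%:R :> R.
  by rewrite ltr0n fiber_card_gt0.
have q0 x : 0 < q x by rewrite !divr_gt0.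
suff : \sum_x lb (q x) <= 0.
  move=> hq; rewrite -subr_le0; apply: le_trans hq; rewrite le_eqVlt.
  apply/predU1P; left; rewrite /entropy opprD -!sumrN -!big_split.
  apply: eq_bigr => x _ /=; have O0 := Omega_gt0 x.
  rewrite /q !lbM ?invr_gt0 ?mulr_gt0 ?invr_gt0 // !lbV //.
  by ring.
apply: sum_lb_le0 => //.
apply: le_trans (_ : \sum_p (fiber_card g p.1)%:R / kappa p.2 <= _).
  apply: (sum_over_fibers gf (phi := fun p => (fiber_card g p.1)%:R / kappa p.2)).
  by move=> v; rewrite divr_ge0 // ltW.
rewrite -(pair_bigA _ (fun a b => (fiber_card g a)%:R / kappa b)) /=.
rewrite -(sum_fiber_card g); apply: ler_sum => a _.
by rewrite -mulr_sumr ler_piMr.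
Qed.

(** Conditional mutual information is nonnegative. Here [phi] gives the counts expected if [f] and
    [g] were independent given [h]; summed over the values of [f] and [g], it leaves the fibre sizes
    of [h], with total [#|Omega|]. *)
Lemma entropy_submodular (A B C : finType)
    (f : Omega -> A) (g : Omega -> B) (h : Omega -> C) :
  entropy (fun x => (f x, (g x, h x))) + entropy h <=
  entropy (fun x => (f x, h x)) + entropy (fun x => (g x, h x)).
Proof.
set fgh := fun x => (f x, (g x, h x)).
set fh := fun x => (f x, h x); set gh := fun x => (g x, h x).
pose phi p : R := (fiber_card fh (p.1, p.2.2))%:R * (fiber_card gh p.2)%:R
  / (fiber_card h p.2.2)%:R.
pose q x := phi (fgh x) / (fiber_card fgh (fgh x))%:R.
have gt0 (U : eqType) (k : Omega -> U) x : 0 < (fiber_card k (k x))%:R :> R.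
  by rewrite ltr0n fiber_card_gt0.
have q0 x : 0 < q x.
  apply: divr_gt0 (gt0 _ fgh x); apply: divr_gt0 (gt0 _ h x).
  exact: mulr_gt0 (gt0 _ fh x) (gt0 _ gh x).
suff : \sum_x lb (q x) <= 0.
  move=> hq; rewrite -subr_le0; apply: le_trans hq; rewrite le_eqVlt.
  apply/predU1P; left.
  rewrite /entropy opprD -!sumrN -!big_split.
  apply: eq_bigr => x _ /=; have O0 := Omega_gt0 x.
  have -> : q x = (fiber_card fh (fh x))%:R * (fiber_card gh (gh x))%:R
    / (fiber_card h (h x))%:R / (fiber_card fgh (fgh x))%:R by [].
  rewrite !lbM ?invr_gt0 ?mulr_gt0 ?invr_gt0 // !lbV //.
  by ring.
apply: sum_lb_le0 => //.
apply: le_trans (_ : \sum_p phi p <= _).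
  apply: sum_over_fibers => v.
  by rewrite divr_ge0 ?mulr_ge0.
rewrite -(pair_bigA _ (fun a b => phi (a, b))) exchange_big /=.
rewrite -(pair_bigA _ (fun b c => \sum_a phi (a, (b, c)))) exchange_big /=.
rewrite -(sum_fiber_card h); apply: ler_sum => c _; rewrite /phi /=.
under eq_bigr => b _ do
  rewrite -mulr_suml -mulr_suml sum_fiber_card_pair mulrAC.
rewrite -mulr_sumr sum_fiber_card_pair.
have [->|n0] := eqVneq (fiber_card h c) 0%N; first by rewrite mulr0.
by rewrite divfK // pnatr_eq0.
Qed.

(** An injection of a finite set into itself is a permutation and preserves the uniform
    distribution. *)
Lemma entropy_comp (T : eqType) (f : Omega -> T) (s : Omega -> Omega) :
  injective s -> entropy (f \o s) = entropy f.
Proof.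
move=> sI; rewrite /entropy [RHS](reindex s) /=; last by apply/onW_bij/injF_bij.
apply: eq_bigr => x _; congr (lb (_ / _%:R)).
rewrite /fiber_card -(card_image sI); apply: eq_card => y.
rewrite [in RHS]inE; apply/imageP/idP => [[z]|yx].
  by rewrite inE => zx ->.
by exists (invF sI y); rewrite ?inE /= f_invF.
Qed.

Lemma entropy_ge (T : eqType) (f : Omega -> T) (c : R) : 0 < c ->
  (forall x, (fiber_card f (f x))%:R * c <= #|Omega|%:R) ->
  #|Omega|%:R * lb c <= entropy f.
Proof.
move=> c0 hf; rewrite mulr_natl -sumr_const.
apply: ler_sum => x _; apply: le_lb => //.
by rewrite ler_pdivlMr ?ltr0n ?fiber_card_gt0 // mulrC.
Qed.

(* Outside [X] the label [f] is its own code; the two kinds of codes share the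
   unit mass equally, which costs one extra bit. *)
Lemma entropy_decode (S : finType) (g : Omega -> S) (r k : nat)
    (f : Omega -> 'I_r) (d : Omega -> 'I_k) (X : {set Omega}) :
  {in X &, forall x y, g x = g y -> d x = d y -> f x = f y} ->
  entropy (fun x => (g x, f x)) <=
  entropy g + #|X|%:R * lb (2 * k%:R) + #|~: X|%:R * lb (2 * r%:R).
Proof.
move=> hd; pose F x : 'I_k + 'I_r := if x \in X then inl (d x) else inr (f x).
apply: le_trans (_ : entropy (fun x => (g x, F x)) <= _).
  apply: entropy_refine => x y; rewrite /F => -[gxy].
  case: ifP => xX; case: ifP => yX // -[exy]; rewrite gxy ?exy //.
  by congr pair; apply: hd.
pose kappa (v : 'I_k + 'I_r) : R := if v is inl _ then 2 * k%:R else 2 * r%:R.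
have ord_gt0 n : 'I_n -> 0 < n%:R :> R.
  by move=> i; rewrite ltr0n (leq_ltn_trans _ (ltn_ord i)).
apply: le_trans (entropy_pair_le g F (kappa := kappa) _ _) _.
- by case=> i; rewrite /= mulr_gt0 // ord_gt0.
- rewrite big_sumType /= !sumr_const !card_ord.
  have half n : ((2 * n%:R)^-1 : R) *+ n <= 2^-1.
    case: n => [|n]; first by rewrite mulr0n invr_ge0.
    by rewrite invfM -[X in X <= _]mulr_natr divfK // pnatr_eq0.
  by have := half k; have := half r; lra.
rewrite -addrA lerD2l (bigID (mem X)) /= le_eqVlt.
apply/predU1P; left; congr (_ + _).
  rewrite (eq_bigr (fun=> lb (2 * k%:R))); last by move=> x; rewrite /F => ->.
  by rewrite sumr_const [RHS]mulr_natl.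
rewrite (eq_bigr (fun=> lb (2 * r%:R))); last by move=> x; rewrite /F => /negbTE ->.
rewrite sumr_const [RHS]mulr_natl; congr (_ *+ _).
by apply: eq_card => x; rewrite !inE.
Qed.

End Entropy.

(** * Words along the orbits of a permutation *)

Section Words.
Local Open Scope ring_scope.
Context {R : realType} {Omega A : finType}.
Variables (S : Omega -> Omega) (x : Omega -> A).
Hypothesis S_inj : injective S.

Local Notation entropy := (@entropy R Omega _).

Definition word m (w : Omega) : {ffun 'I_m -> A} := [ffun i : 'I_m => x (iter i S w)].

Lemma eq_word m v w :
  (forall i, (i < m)%N -> x (iter i S v) = x (iter i S w)) <->
  word m v = word m w.
Proof.
split=> [h|/ffunP h i im]; first by apply/ffunP => i; rewrite !ffunE h.
by have := h (Ordinal im); rewrite !ffunE.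
Qed.

Lemma lb_nat (n : nat) : lb (n%:R : R) <= n%:R.
Proof.
case: n => [|n]; first by rewrite /lb ln0 // mul0r.
rewrite -[leRHS]lb2X; apply: le_lb; first by rewrite ltr0n.
by rewrite -natrX ler_nat ltnW // ltn_expl.
Qed.

Lemma entropy_le_lb_card (T : finType) (f : Omega -> T) :
  entropy f <= #|Omega|%:R * lb #|T|%:R.
Proof.
have [O0|O0] := posnP #|Omega|.
  rewrite /entropy O0 mul0r big1 // => w _; exfalso.
  by move: (card0_eq O0 w); rewrite inE.
have T0 : (0 < #|T|)%N by case/card_gt0P: O0 => w _; apply/card_gt0P; exists (f w).
apply: le_trans (_ : entropy (fun w => (tt, f w)) <= _).
  by apply: entropy_refine => v w [].
apply: le_trans (entropy_pair_le (fun=> tt) f (kappa := fun=> #|T|%:R) _ _) _.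
- by move=> v; rewrite ltr0n.
- by rewrite sumr_const -[X in X <= _]mulr_natr mulVf // pnatr_eq0 -lt0n.
rewrite sumr_const -[X in _ + X]mulr_natl (_ : entropy _ = 0) ?add0r //.
rewrite /entropy big1 // => w _.
rewrite (_ : fiber_card _ _ = #|Omega|); last by apply: eq_card => v; rewrite !inE.
by rewrite divff ?pnatr_eq0 -?lt0n // /lb ln1 mul0r.
Qed.

Lemma entropy_le_card (T : finType) (f : Omega -> T) :
  entropy f <= #|Omega|%:R * #|T|%:R.
Proof.
by apply: le_trans (entropy_le_lb_card f) _; rewrite ler_wpM2l // lb_nat.
Qed.

(** Conditionally on [t], a concatenation costs at most the sum of its blocks: submodularity,
    applied with [t] as common label, adds one block at a time. *)
Lemma entropy_word_mul (T : finType) (t : Omega -> T) (m Q : nat) (B : R) :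
  (forall i, (i < Q)%N ->
    entropy (fun w => (word m (iter (i * m) S w), t w)) <= entropy t + B) ->
  entropy (fun w => (word (Q * m) w, t w)) <= entropy t + Q%:R * B.
Proof.
elim: Q => [|Q IH] hB.
  rewrite mul0r addr0; apply: entropy_refine => v w ->.
  by congr pair; apply/eq_word => i; rewrite mul0n.
have {}IH := IH (fun i iQ => hB i (ltnW iQ)).
have {}hB := hB Q (ltnSn Q).
have := entropy_submodular (R := R) (word (Q * m))
  (fun w => word m (iter (Q * m) S w)) t.
suff : entropy (fun w => (word (Q.+1 * m) w, t w)) <=
    entropy (fun w => (word (Q * m) w, (word m (iter (Q * m) S w), t w))).
  by rewrite -natr1; lra.
apply: entropy_refine => v w [/eq_word h1 /eq_word h2 ->]; congr pair.
apply/eq_word => i; rewrite mulSn addnC => im.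
have [/h1 //|Qi] := ltnP i (Q * m).
have := h2 (i - Q * m)%N; rewrite -!iterD subnK //; apply; lia.
Qed.

(** [t] is paid for once, then every block is described given [t]. In a block [t] is nearly free
    wherever [d] decodes it from the word, while conditioning on it saves the entropy of [t], which
    equidistribution keeps above [lb r - lb C] per point. *)
Lemma entropy_word_step (m Q r k k' C : nat) (t : Omega -> 'I_r)
    (d : Omega -> 'I_k) (e : nat -> Omega -> 'I_k') (G good : {set Omega}) :
  (0 < C)%N ->
  {in G &, forall v w, word m v = word m w -> d v = d w -> t v = t w} ->
  (forall i, (i < Q)%N -> {in good &, forall v w,
    t (iter (i * m) S v) = t (iter (i * m) S w) -> e i v = e i w -> t v = t w}) ->
  (forall v, fiber_card t v * r <= C * #|Omega|)%N ->
  entropy (word (Q * m)) <= #|Omega|%:R * lb r%:R + Q%:R *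
    (entropy (word m) + #|G|%:R * lb (2 * k%:R) + #|~: G|%:R * lb (2 * r%:R)
     + #|good|%:R * lb (2 * k'%:R) + #|~: good|%:R * lb (2 * r%:R)
     - #|Omega|%:R * (lb r%:R - lb C%:R)).
Proof.
move=> C0 hG hgood ht.
have [O0|O0] := posnP #|Omega|.
  have Z (X : {set Omega}) : #|X| = 0%N.
    by apply/eqP; rewrite -leqn0 -O0 max_card.
  have E (T : finType) (f : Omega -> T) : entropy f = 0.
    apply/eqP; rewrite eq_le entropy_ge0 andbT.
    by have := entropy_le_card f; rewrite O0 mul0r.
  by rewrite O0 !Z !E !mul0r subr0 !addr0 mulr0 addr0.
have r0 : (0 < r)%N by case/card_gt0P: O0 => w _; apply: leq_ltn_trans (ltn_ord (t w)).
have t_le : entropy t <= #|Omega|%:R * lb r%:R.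
  by have := entropy_le_lb_card t; rewrite card_ord.
have t_ge : #|Omega|%:R * (lb r%:R - lb C%:R) <= entropy t.
  rewrite -lbV ?ltr0n // -lbM ?invr_gt0 ?ltr0n //; apply: entropy_ge.
    by rewrite divr_gt0 ?ltr0n.
  move=> w; rewrite mulrA ler_pdivrMr ?ltr0n // -!natrM ler_nat mulnC.
  by rewrite (mulnC _ C) mulnC ht.
set B := _ - _.
have step i : (i < Q)%N ->
    entropy (fun w => (word m (iter (i * m) S w), t w)) <= entropy t + B.
  move=> iQ; pose sh := iter (i * m) S.
  have sh_inj : injective sh.
    by rewrite /sh; elim: (i * m)%N => [|j IH] v w //= /S_inj /IH.
  (* Inserting [t] at the shifted time gives a shifted copy of the pair [(word m, t)], of the same
     entropy; the code [e i] then recovers the unshifted [t]. *)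
  apply: le_trans (_ : entropy (fun w => ((word m (sh w), t (sh w)), t w)) <= _).
    by apply: entropy_refine => v w [-> _ ->].
  have h1 : {in good &, forall v w, (word m (sh v), t (sh v)) =
      (word m (sh w), t (sh w)) -> e i v = e i w -> t v = t w}.
    by move=> v w vg wg [_]; apply: hgood.
  apply: le_trans (entropy_decode h1) _.
  have := entropy_comp (R := R) (fun w => (word m w, t w)) sh_inj.
  rewrite /comp /= => ->.
  have := entropy_decode (R := R) hG.
  by rewrite /B; lra.
apply: le_trans (le_trans (entropy_refine _) (entropy_word_mul step)) _.
  by move=> v w [].
by lra.
Qed.

End Words.

(** * Descent of the entropy per letter *)

Section Core.
Local Open Scope ring_scope.

(* The label [t] plays the angle at resolution [2^-m]: equidistributed, known up
   to [k'] values from any of its shifts, yet on a proportion [1/e] of the times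
   determined by a word of length [m] and one of [2^((1 - 1/q) m)] codes [d]. *)
Lemma entropy_core (R : realType) (A : finType) (e q D k' C : nat) :
  (0 < e)%N -> (0 < q)%N -> (0 < C)%N -> exists M : nat,
  forall (Omega : finType) (S : Omega -> Omega) (x : Omega -> A)
    (good : {set Omega}),
  injective S -> (M.+1 ^ 2 <= #|Omega|)%N -> (#|~: good| <= M)%N ->
  (forall m : nat, (m <= M)%N -> exists (k : nat) (t : Omega -> 'I_(2 ^ m))
      (d : Omega -> 'I_k) (G : {set Omega}),
    [/\ (#|Omega| <= e * #|G|)%N, (k ^ q <= D * 2 ^ (q.-1 * m))%N,
     {in G &, forall v w,
       (forall i, (i < m)%N -> x (iter i S v) = x (iter i S w)) ->
       d v = d w -> t v = t w},
     forall s, (s <= M)%N -> exists c : Omega -> 'I_k', {in good &, forall v w,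
       t (iter s S v) = t (iter s S w) -> c v = c w -> t v = t w} &
     forall v, (fiber_card t v * 2 ^ m <= C * #|Omega|)%N]) ->
  False.
Proof.
move=> e0 q0 C0.
(* With [z = q * e], [n] the number of times and unit [y = n * m / (8 * z)]: a block of length [m]
   saves [4 * y] through the determined angles; the payment [n * m] for [t], spread over [Q] blocks,
   costs [y]; the terms [n * (3 + k' + C)] cost at most [y] once [m >= m1]. The net saving [2 * y]
   makes [h m / m] drop by [n / (4 * z)]. *)
pose Q := (8 * (q * e))%N.
pose m1 := (2 * D + Q * (3 + k' + C)).+1.
pose h0 := #|{ffun 'I_m1 -> A}|.
(* [L] drops add up to [n * (h0 + 1)], more than the initial ratio, which is at most [n * h0]. *)
pose L := (4 * (q * e) * h0.+1)%N.
have Q0 : (0 < Q)%N by rewrite /Q !muln_gt0 q0 e0.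
exists (m1 * Q ^ L)%N; set M := (_ * _)%N.
move=> Omega S x good S_inj hM hgood hyp.
set n := #|Omega|%:R : R.
have n0 : 0 < n by rewrite ltr0n; apply: leq_trans hM; rewrite expn_gt0.
pose h m := entropy (R := R) (word S x m).
pose z : R := (q * e)%:R.
have z1 : 1 <= z by rewrite ler1n muln_gt0 q0 e0.
have step m : (m1 <= m)%N -> (Q * m <= M)%N ->
    h (Q * m)%N <= Q%:R * (h m - n * m%:R / (4 * z)).
  move=> m1m mM.
  have [|k [t [d [G [hG hk det sh ft]]]]] := hyp m.
    by apply: leq_trans mM; rewrite leq_pmull.
  (* The codes for all [i < Q] are chosen at once in finite function types, where the required
     property is decidable and [xchoose] applies; larger [i] reuse the code of 0. *)
  have [c hc] : exists c : nat -> Omega -> 'I_k', forall i, (i < Q)%N ->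
     {in good &, forall v w, t (iter (i * m) S v) = t (iter (i * m) S w) ->
        c i v = c i w -> t v = t w}.
    have ex i : exists ci : Omega -> 'I_k', (i < Q)%N ->
     {in good &, forall v w, t (iter (i * m) S v) = t (iter (i * m) S w) ->
        ci v = ci w -> t v = t w}.
      have [iQ|iQ] := ltnP i Q.
        have [|ci hci] := sh (i * m)%N; last by exists ci.
        by apply: leq_trans mM; rewrite leq_mul2r ltnW ?orbT.
      by have [|ci _] := sh 0%N; last by exists ci.
    suff [c hc] : exists c : {ffun 'I_Q -> {ffun Omega -> 'I_k'}},
      forall i : 'I_Q, {in good &, forall v w,
        t (iter (i * m) S v) = t (iter (i * m) S w) ->
        c i v = c i w -> t v = t w}.
      exists (fun i w => if insub i is Some j then c j w else c (Ordinal Q0) w).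
      by move=> i iQ; rewrite insubT; apply: (hc (Sub i iQ)).
    have fin (i : 'I_Q) : exists ci : {ffun Omega -> 'I_k'},
        [forall v in good, forall w in good,
         (t (iter (i * m) S v) == t (iter (i * m) S w)) ==>
         (ci v == ci w) ==> (t v == t w)].
      have [ci hci] := ex i; exists [ffun w => ci w].
      apply/forall_inP => v vg; apply/forall_inP => w wg.
      apply/implyP => /eqP tt; rewrite !ffunE; apply/implyP => /eqP cc.
      by apply/eqP; apply: hci.
    exists [ffun i => xchoose (fin i)] => i v w vg wg tt; rewrite ffunE => cc.
    have /forall_inP/(_ v vg)/forall_inP/(_ w wg) := xchooseP (fin i).
    by rewrite tt cc !eqxx => /eqP.
  have hG' : {in G &, forall v w, word S x m v = word S x m w -> d v = d w -> t v = t w}.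
    by move=> v w vG wG /eq_word; apply: det.
  have := entropy_word_step (R := R) S_inj C0 hG' hc ft.
  rewrite -/(h _) -/(h _) -/n.
  have O0 : (0 < #|Omega|)%N by apply: leq_trans hM; rewrite expn_gt0.
  have [w _] := card_gt0P O0.
  have k0 : (0 < k)%N by apply: leq_ltn_trans (ltn_ord (d w)).
  have [//|c0 _] := sh 0%N.
  have k'0 : (0 < k')%N by apply: leq_ltn_trans (ltn_ord (c0 w)).
  have D0 : (0 < D)%N.
    by have := leq_trans (_ : 0 < k ^ q)%N hk; rewrite expn_gt0 k0 muln_gt0 => /(_ isT) /andP[].
  rewrite natrX !lbM ?ltr0n ?exprn_gt0 // lb2 lb2X.
  have lbk : q%:R * lb k%:R <= D%:R + (q%:R - 1) * m%:R :> R.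
    have : lb ((k ^ q)%:R : R) <= lb ((D * 2 ^ (q.-1 * m))%:R : R).
      by apply: le_lb; rewrite ?ltr0n ?expn_gt0 ?k0 // ler_nat.
    rewrite natrM !natrX lbM ?exprn_gt0 ?ltr0n // lb2X natrM.
    rewrite lbX ?ltr0n //.
    rewrite -[in q.-1%:R]subn1 natrB //.
    by have := lb_nat (R := R) D; lra.
  have GG : #|G|%:R + #|~: G|%:R = n :> R by rewrite -natrD cardsC.
  have gg : #|good|%:R + #|~: good|%:R = n :> R by rewrite -natrD cardsC.
  have lbk' := lb_nat (R := R) k'.
  have lbC := lb_nat (R := R) C.
  have k'_ge0 : 0 <= lb (k'%:R : R) by rewrite lb_ge0 // ler1n.
  have q1 : 1 <= q%:R :> R by rewrite ler1n.
  (* By [lbk] and [m >= 2 * D], a code [d] is at least [m / (2 * q)] bits shorter than [t]. Over the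
     proportion [1 / e] of times in [G] this becomes [main]. *)
  have gain : m%:R / 2 <= q%:R * (m%:R - lb (k%:R : R)).
    have : (2 * D)%:R <= m%:R :> R by rewrite ler_nat; rewrite /m1 in m1m; lia.
    by rewrite natrM; lra.
  have Gn : n <= e%:R * #|G|%:R by rewrite -natrM ler_nat.
  have mb : Q%:R * (3 + k'%:R + C%:R) <= m%:R :> R.
    by rewrite -!natrD -natrM ler_nat; rewrite /m1 in m1m; lia.
  (* At most [M] bad times cost [1 + m <= M + 1] bits each, and [Omega] has at least [M.+1 ^ 2]
     points. *)
  have bad : #|~: good|%:R * (1 + m%:R) <= n.
    rewrite nat1r -natrM ler_nat; apply: leq_trans hM.
    rewrite expnS expn1 leq_mul //; first exact: leqW.
    by rewrite ltnS (leq_trans _ mM) // leq_pmull.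
  have QE : Q%:R = 8 * z :> R by rewrite /Q natrM.
  set g := #|G|%:R in GG Gn *; set lk := lb k%:R in lbk gain *.
  have main : n * (m%:R / (2 * z)) <= g * (m%:R - lk).
    have gain' : 0 <= m%:R - lk.
      have : 0 <= q%:R * (m%:R - lk) by apply: le_trans gain; rewrite divr_ge0.
      by rewrite pmulr_rge0 // ltr0n.
    rewrite mulrA ler_pdivrMr ?mulr_gt0 //; last by lra.
    rewrite /z natrM.
    have e1 : 1 <= e%:R :> R by rewrite ler1n.
    have h1 := ler_wpM2r gain' Gn.
    have g0 : 0 <= g by rewrite ler0n.
    have m_ge0 : 0 <= m%:R :> R by rewrite ler0n.
    have h2 : n * (m%:R / 2) <= n * (q%:R * (m%:R - lk)) by rewrite ler_wpM2l // ltW.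
    have h3 := ler_wpM2l (ler0n R q) h1.
    by nra.
  move=> H; apply: le_trans H _; rewrite QE.
  have mz : 3 + k'%:R + C%:R <= m%:R / (8 * z).
    by rewrite ler_pdivlMr ?mulr_gt0 // ?(lt_le_trans _ z1) // mulrC -QE.
  have z0 : z != 0 by rewrite gt_eqF // (lt_le_trans ltr01).
  clearbody z.
  have E1 : n * m%:R = 8 * z * (n * (m%:R / (8 * z))).
    by field.
  have E2 : n * (m%:R / (2 * z)) = 4 * (n * (m%:R / (8 * z))).
    by field.
  have E3 : n * m%:R / (4 * z) = 2 * (n * (m%:R / (8 * z))).
    by field.
  rewrite {1}E1 E3 -mulrDr ler_pM2l; last by lra.
  rewrite E2 in main.
  have mz' := ler_wpM2l (ltW n0) mz.
  have Gc : #|~: G|%:R = n - g by lra.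
  have goodc : #|good|%:R <= n by rewrite -gg lerDl ler0n.
  have h5 : #|good|%:R * (1 + lb k'%:R) <= n * (1 + k'%:R).
    by apply: ler_pM; rewrite ?ler0n ?addr_ge0 //; lra.
  have h6 : n * lb C%:R <= n * C%:R by rewrite ler_wpM2l // ltW.
  rewrite Gc; set y := n * (m%:R / (8 * z)) in main mz' *.
  by clearbody y; lra.
have iter_step i : (i <= L)%N ->
    h (m1 * Q ^ i)%N <= (m1 * Q ^ i)%:R * (n * h0%:R - i%:R * (n / (4 * z))).
  elim: i => [|i IH] iL.
    rewrite expn0 muln1 mul0r subr0 -[leLHS]mul1r ler_pM ?ler01 //.
    - exact: entropy_ge0.
    - by rewrite ler1n.
    - exact: entropy_le_card.
  have {}IH := IH (ltnW iL).
  rewrite expnS mulnCA; apply: le_trans (step _ _ _) _.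
  - by rewrite leq_pmulr // expn_gt0 Q0.
  - by rewrite mulnCA -expnS leq_mul // leq_pexp2l.
  rewrite [X in _ <= X * _]natrM -[leRHS]mulrA ler_wpM2l //.
  rewrite -[i.+1%:R]natr1; set mm := (m1 * Q ^ i)%:R in IH *.
  have -> : n * mm / (4 * z) = mm * (n / (4 * z)) by rewrite mulrAC mulrC mulrA.
  by set y := n / (4 * z) in IH *; clearbody y; lra.
have {iter_step} hle := iter_step L (leqnn L).
have M0 : 0 < (m1 * Q ^ L)%:R :> R by rewrite ltr0n muln_gt0 expn_gt0 Q0.
have hge : 0 <= h (m1 * Q ^ L)%N by apply: entropy_ge0.
have {}hle := le_trans hge hle; move: hle; rewrite pmulr_rge0 //.
have -> : L%:R = 4 * z * (h0%:R + 1) :> R by rewrite natr1 -!natrM.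
clearbody z h0 n => {step hge M0}.
suff -> : n * h0%:R - 4 * z * (h0%:R + 1) * (n / (4 * z)) = - n by lra.
by field; rewrite gt_eqF // (lt_le_trans ltr01).
Qed.
End Core.

(** * A window of times as a finite cyclic system *)

Lemma Nat_pow_expn (m n : nat) : Nat.pow m n = expn m n.
Proof. by elim: n => [|n IH] //=; rewrite IH expnS. Qed.

Lemma val_iter_ordS n i (w : 'I_n) : iter i (@ordS n) w = ((w + i) %% n)%N :> nat.
Proof.
elim: i => [|i IH]; first by rewrite addn0 modn_small.
by rewrite iterS /= IH -addn1 modnDml addn1 addnS.
Qed.

Lemma count_window_card (P : nat -> Prop) (k n : nat) :
  count_window P k n =
  #|[set w : 'I_n | excluded_middle_informative (P (k.+1 + w)%N)]|.
Proof.
rewrite -sum1dep_card; elim: n => [|n IH]; first by rewrite big_ord0.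
rewrite [RHS]big_mkcond big_ord_recr /= -big_mkcond /= -IH.
have -> : Nat.add k n.+1 = (k.+1 + n)%N by rewrite plusE addnS.
by case: excluded_middle_informative.
Qed.

Lemma card_tail_le n M : (#|[set w : 'I_n | n <= w + M]| <= M)%N.
Proof.
set s := [seq (n.-1 - w)%N | w : 'I_n <- enum [set w : 'I_n | n <= w + M]%N].
have s_uniq : uniq s.
  rewrite map_inj_in_uniq ?enum_uniq // => v w _ _ E; apply: val_inj.
  by have := ltn_ord v; have := ltn_ord w; move: E => /=; lia.
have s_sub : {subset s <= iota 0 M}.
  move=> x /mapP[w]; rewrite mem_enum inE => hw ->; rewrite mem_iota.
  by have := ltn_ord w; lia.
by have := uniq_leq_size s_uniq s_sub; rewrite size_iota size_map -cardE.
Qed.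

Lemma In_mem (T : eqType) (x : T) (s : seq T) : In x s -> x \in s.
Proof.
by elim: s => [|y s IH] //= [->|/IH xs]; rewrite inE ?eqxx // xs orbT.
Qed.

Lemma uniq_NoDup (T : eqType) (s : seq T) : uniq s -> NoDup s.
Proof.
elim: s => [|y s IH] /=; first by move=> _; constructor.
by case/andP => ys /IH sN; constructor => // /In_mem; apply/negP.
Qed.

Definition symbol (a b : R) (j : nat) : 'I_2 * 'I_2 * 'I_3 :=
  (inord (digit2 a j), inord (jump j), inord (digit3 b j)).

Lemma symbol_eq a b i j : symbol a b i = symbol a b j ->
  digit2 a i = digit2 a j /\ digit3 b i = digit3 b j /\ jump i = jump j.
Proof.
have inordE n (x y : nat) : (x < n.+1)%N -> (y < n.+1)%N ->
    inord x = inord y :> 'I_n.+1 -> x = y.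
  by move=> xn yn /(congr1 val); rewrite /= !inordK.
case=> /inordE h1 /inordE h2 /inordE h3; split; [|split].
- by apply: h1; apply/ssrnat.ltP; apply: digit2_lt.
- by apply: h3; apply/ssrnat.ltP; apply: digit3_lt.
- by apply: h2; apply/ssrnat.ltP; apply: jump_lt.
Qed.

(** A window with too many indices would give [entropy_core] its impossible data: [Omega] is the
    window with its cyclic successor and [t] is [cell m]. The codes come from [slice_coding] and
    [cell_shift_code], equidistribution from [cell_frequency_uniform]. *)
Lemma uniform_sparse (A2 A3 : R -> Prop) (gamma eps : R) :
  closed_set A2 -> closed_set A3 ->
  (forall x, A2 x -> 0 <= x <= 1) -> (forall x, A3 x -> 0 <= x <= 1) ->
  times_p_invariant 2 A2 -> times_p_invariant 3 A3 ->
  (exists d2 d3 : R, is_dimH A2 d2 /\ is_dimH A3 d3 /\ d2 + d3 < 1) ->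
  0 < gamma -> 0 < eps ->
  exists N0 : nat, forall (u v a : R) (k N : nat),
    gamma < Rabs u < / gamma -> l_uv A2 A3 u v a -> (N0 <= N)%coq_nat ->
    INR (count_window (W_at (l_uv A2 A3 u v) a) k N) <= eps * INR N.
Proof.
move=> c2 c3 b2 b3 i2 i3 hd g0 e0.
have [q [D [/ssrnat.leP q1 hcode]]] := slice_coding A2 A3 gamma c2 c3 b2 b3 i2 i3 hd g0.
have [e [/ssrnat.leP e1 hmargin]] := density_margin eps e0.
(* 4 bounds the codes of [cell_shift_code], and 8 is the constant of [cell_frequency_uniform]. *)
have [M hM] := entropy_core R ('I_2 * 'I_2 * 'I_3)%type D 4 e1 q1 (isT : 0 < 8)%N.
have [N1 {}hmargin] := hmargin M.
have [N2 hfreq] := cell_frequency_uniform M.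
exists (N1 + N2 + M.+1 ^ 2)%N => u v a k n hu [A2a [b [A3b ab]]] /ssrnat.leP hn.
apply: Rnot_lt_le => hlt.
have {}hmargin : (n <= e * (count_window (W_at (l_uv A2 A3 u v) a) k n - M))%N.
  apply/ssrnat.leP; apply: hmargin hlt; apply/ssrnat.leP.
  by apply: leq_trans hn; rewrite -addnA leq_addr.
rewrite count_window_card in hmargin; set H := [set _ | _] in hmargin.
have n_big : (M.+1 ^ 2 <= n)%N by apply: leq_trans hn; rewrite leq_addl.
have n2 : (N2 <= n)%N by apply: leq_trans hn; rewrite -addnA addnCA leq_addr.
(* The window starts at [k + 1], so all times are positive, as [slice_coding] asks. At [good] times
   the next [M] steps do not wrap around, and the cyclic orbit follows actual times. *)
pose time (w : 'I_n) := (k.+1 + w)%N.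
pose good := [set w : 'I_n | (w + M < n)%N].
have time_iter (w : 'I_n) i : (w + i < n)%N ->
    time (iter i (@ordS n) w) = (time w + i)%N.
  by move=> wi; rewrite /time val_iter_ordS modn_small // addnA.
have badM : (#|~: good| <= M)%N.
  apply: leq_trans (card_tail_le n M); apply/subset_leq_card/subsetP => w.
  by rewrite !inE -leqNgt.
apply: (hM 'I_n (@ordS n) (fun w => symbol a b (time w)) good) => //.
- exact: ordS_inj.
- by rewrite card_ord.
move=> m mM; have [K [/ssrnat.leP hK {}hcode]] := hcode m.
have [d [dK hdet]] := hcode u v a b hu ab.
have cellP (w : 'I_n) : (cell m (time w) < 2 ^ m)%N.
  by rewrite -Nat_pow_expn; apply/ssrnat.ltP/cell_lt.
pose t w := Ordinal (cellP w).
(* Decoding takes place at indices of the sparse index whose word does not wrap around; the at most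
   [M] indices lost are those subtracted in [hmargin]. *)
exists K, t, (fun w => Ordinal (introT ssrnat.ltP (dK (time w)))), (H :&: good).
split.
- rewrite card_ord; apply: leq_trans hmargin _; rewrite leq_mul2l; apply/orP; right.
  rewrite leq_subLR -(cardsID good H) addnC leq_add2r.
  by apply: leq_trans badM; rewrite setDE subset_leq_card // subsetIr.
- by move: hK; rewrite !Nat_pow_expn multE minusE subn1.
- move=> w1 w2; rewrite !inE => /andP[H1 g1] /andP[H2 g2] hx [hd12].
  apply: val_inj => /=; apply: hdet hd12.
  + exact/ssrnat.leP.
  + exact/ssrnat.leP.
  + by move: H1; case: excluded_middle_informative.
  + by move: H2; case: excluded_middle_informative.
  move=> i /ssrnat.ltP im; apply: symbol_eq.
  have lt_n (w : 'I_n) : (w + M < n)%N -> (w + i < n)%N by lia.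
  by rewrite !plusE -!time_iter ?lt_n //; apply: hx.
- move=> s sM; have [c [c4 hc]] := cell_shift_code m s.
  exists (fun w => Ordinal (introT ssrnat.ltP (c4 (time w)))).
  move=> w1 w2; rewrite !inE => g1 g2 [ht] [hc12].
  apply: val_inj; apply: hc hc12.
  have lt_n (w : 'I_n) : (w + M < n)%N -> (w + s < n)%N by lia.
  by rewrite !plusE -!time_iter ?lt_n.
move=> c; rewrite card_ord.
pose l := [seq val w | w <- enum [pred w | t w == c]].
have := hfreq m n k.+1 (val c) l (elimT ssrnat.leP mM) (elimT ssrnat.leP n2).
have -> : length l = fiber_card t c by rewrite [LHS]size_map /fiber_card cardE.
rewrite Nat_pow_expn => hl; apply/ssrnat.leP; apply: hl.
  by apply: uniq_NoDup; rewrite map_inj_uniq ?enum_uniq //; apply: val_inj.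
move=> j /In_mem /mapP[w]; rewrite mem_enum inE => /eqP tw ->.
split; first exact: (elimT ssrnat.ltP (ltn_ord w)).
by rewrite -tw plusE.
Qed.

End Combinatorics.

Theorem theorem8p4 (A2 A3 : R -> Prop) :
  closed_set A2 -> closed_set A3 ->
  (forall x, A2 x -> 0 <= x <= 1) -> (forall x, A3 x -> 0 <= x <= 1) ->
  times_p_invariant 2 A2 -> times_p_invariant 3 A3 ->
  (exists d2 d3 : R, is_dimH A2 d2 /\ is_dimH A3 d3 /\ d2 + d3 < 1) ->
  (forall u v a : R, u <> 0 -> l_uv A2 A3 u v a ->
     super_sparse_near (l_uv A2 A3 u v) a) /\
  (forall gamma eps : R, 0 < gamma -> 0 < eps ->
     exists N0 : nat, forall (u v a : R) (k N : nat),
       gamma < Rabs u < / gamma -> l_uv A2 A3 u v a -> (N0 <= N)%nat ->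
       INR (count_window (W_at (l_uv A2 A3 u v) a) k N) <= eps * INR N).
Proof.
  intros Hc2 Hc3 H2 H3 HA2 HA3 Hd.
  assert (Huniform : forall gamma eps : R, 0 < gamma -> 0 < eps ->
     exists N0 : nat, forall (u v a : R) (k N : nat),
       gamma < Rabs u < / gamma -> l_uv A2 A3 u v a -> (N0 <= N)%nat ->
       INR (count_window (W_at (l_uv A2 A3 u v) a) k N) <= eps * INR N)
    by (intros; now apply uniform_sparse).
  split; [|exact Huniform].
  intros u v a Hu Ha eps Heps.
  assert (Hu0 : 0 < Rabs u) by now apply Rabs_pos_lt.
  assert (Hui : 0 < / Rabs u) by now apply Rinv_0_lt_compat.
  (* Halving the minimum makes both inequalities [g < |u| < 1 / g] strict, so the uniform bound
     covers this single [u]. *)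
  set (g := Rmin (Rabs u) (/ Rabs u) / 2).
  assert (Hmin : 0 < Rmin (Rabs u) (/ Rabs u)) by now apply Rmin_pos.
  assert (Hg : 0 < g) by (unfold g; lra).
  destruct (Huniform g eps Hg Heps) as [N0 HN0].
  exists N0. intros N HN k. apply HN0; [|exact Ha|exact HN].
  pose proof (Rmin_l (Rabs u) (/ Rabs u)). pose proof (Rmin_r (Rabs u) (/ Rabs u)).
  split; [unfold g; lra|].
  rewrite <- (Rinv_inv (Rabs u)). apply Rinv_lt_contravar; [|unfold g; lra].
  now apply Rmult_lt_0_compat.
Qed.
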